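(* Let $G$ be a connected complex semisimple algebraic group of adjoint type and rank $l$, let $\overline G$ be its wonderful compactification, and let $z=F(z_1,\dots,z_l)\in Z$ with $(z_1,\dots,z_l)\in\mathbb C^l$. Then the infinitesimal actions $dL,dR:\mathfrak g\to T_z\overline G$ are given, for $\alpha\in\Phi^+$ and $1\le i\le l$, by $$dL(x_\alpha)=-dA(x_\alpha),\qquad dL(y_\alpha)=\prod_{i=1}^l z_i^{\langle\lambda_i^\vee,\alpha\rangle}\,dA(y_\alpha),\qquad dL(h_i)=-\sum_{j=1}^l a_{ij}z_j\,dA(e_j),$$ and $$dR(x_\alpha)=-\prod_{i=1}^l z_i^{\langle\lambda_i^\vee,\alpha\rangle}\,dA(x_\alpha),\qquad dR(y_\alpha)=dA(y_\alpha),\qquad dR(h_i)=-\sum_{j=1}^l a_{ij}z_j\,dA(e_j).$$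
   Context: $T\subset B\subset G$ are a maximal torus and a Borel subgroup, with Lie algebras $\mathfrak t\subset\mathfrak b\subset\mathfrak g$; $\Phi^+$ the positive roots, $\alpha_1,\dots,\alpha_l$ the simple roots, $\alpha_i^\vee$ the simple coroots, $a_{ij}=\langle\alpha_i^\vee,\alpha_j\rangle$, $\lambda_i^\vee\in\mathfrak t$ the fundamental coweights (dual to the $\alpha_i$). $U^+$, $U^-$ are the unipotent radicals of $B$ and of the opposite Borel, with Lie algebras $\mathfrak u^\pm$. For $\alpha\in\Phi^+$, $x_\alpha\in\mathfrak g_\alpha$, $y_\alpha\in\mathfrak g_{-\alpha}$, $h_\alpha=\alpha^\vee$ is a standard $\mathfrak{sl}_2$-triple; $h_i=h_{\alpha_i}=\alpha_i^\vee$. Let $V$ be an irreducible representation of the universal cover $\tilde G$ with regular highest weight $\lambda$; $\overline G$ is the closure of the image of $\psi:G\hookrightarrow\mathbb P(\mathrm{End}\,V)$, $g\mapsto[\tilde g]$. Let $v_0,\dots,v_n$ be a basis of weight vectors of $V$, $v_0$ of weight $\lambda$, $v_i$ of weight $\lambda-\alpha_i$ for $1\le i\le l$, and $v_k$ of weight $\lambda-\sum_i n_{ik}\alpha_i$ for $k>l$. Put $\varphi_k=v_k\otimes v_k^*$, $\mathbb P_0=\{[\varphi]:v_0^*(\varphi v_0)\ne0\}$, $G_0=\overline G\cap\mathbb P_0$, $Z=\overline{\psi(T)}\cap\mathbb P_0$. The map $F:\mathbb C^l\to Z$, $F(z_1,\dots,z_l)=\big[\varphi_0+\sum_{i=1}^l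 z_i\varphi_i+\sum_{k>l}\prod_i z_i^{n_{ik}}\varphi_k\big]$, is an isomorphism, with $\psi(t)=F(\alpha_1(t)^{-1},\dots,\alpha_l(t)^{-1})$ for $t\in T$. The map $A:U^-\times U^+\times Z\to G_0$, $(u_-,u_+,t)\mapsto[u_-tu_+^{-1}]$, is an isomorphism. $dA$ denotes the differential $dA_{(e,e,z)}:\mathfrak u^-\oplus\mathfrak u^+\oplus\mathbb C^l\to T_z\overline G$, where $T_zZ$ is identified with $\mathbb C^l$ via $F$, and $e_1,\dots,e_l$ is the standard basis of $\mathbb C^l$; the $dA(x_\alpha),dA(y_\alpha)$ ($\alpha\in\Phi^+$), $dA(e_j)$ form a basis of $T_z\overline G$. $dL$ and $dR$ are the differentials at $e$ of the maps $L_z,R_z:G\to\overline G$, $L_z(g)=[zg]$, $R_z(g)=[gz]$. *)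

(* Defs.v *)
(* Linear algebraic groups are Zariski closed subgroups of GL_N(K), handled as
   sets of N x N matrices.  Every variety is a set X of points in an ambient
   space with functions; morphisms, tangent vectors and differentials are
   those of the theory of spaces with functions: a tangent vector is a point
   derivation of the local ring, and the differential of h sends a
   derivation delta to f |-> delta (f \o h). *)
From mathcomp Require Import all_boot all_order all_algebra.
From mathcomp Require Import complex mpoly.
From mathcomp Require Import boolp classical_sets functions cardinality reals.
Set Implicit Arguments.
Unset Strict Implicit.
Unset Printing Implicit Defensive.
Import Order.TTheory GRing.Theory Num.Theory.
Local Open Scope ring_scope.
Local Open Scope classical_set_scope.

(* [regular_at x f]: f is regular on some neighbourhood of x.  Functions are
   total, and the values of f away from that neighbourhood are arbitrary. *)
Record space (K : fieldType) := Space {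
  point : Type;
  regular_at : point -> set (point -> K) }.

Definition peval (K : fieldType) (W : vectType K)
    (p : {mpoly K[\dim {:W}]}) (w : W) : K :=
  p.@[fun i => coord (vbasis {:W}) i w].

Definition affine (K : fieldType) (W : vectType K) : space K :=
  @Space K W (fun w => [set f | exists a b : {mpoly K[\dim {:W}]},
    peval b w != 0 /\
    forall v, peval b v != 0 -> f v = peval a v / peval b v]).

(* The points of P(W) are the lines <[w]>, w != 0, in W; the other subspaces
   are junk points. *)
Definition projective (K : fieldType) (W : vectType K) : space K :=
  @Space K {vspace W} (fun L => [set f |
    exists (d : nat) (a b : {mpoly K[\dim {:W}]}),
    [/\ a \is d.-homog, b \is d.-homog, peval b (vpick L) != 0 &
        forall v, v != 0 -> peval b v != 0 ->
          f <[v]>%VS = peval a v / peval b v]]).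

(* x is in the Zariski closure of A iff no function regular at x vanishes on A
   but not at x: clearing the denominator of such a function gives a
   (homogeneous) polynomial vanishing on A and not at x, and conversely. *)
Definition zclosure (K : fieldType) (E : space K) (A : set (point E)) :
    set (point E) :=
  [set x | forall f, regular_at x f -> (forall a, A a -> f a = 0) -> f x = 0].

Definition zclosed_in (K : fieldType) (E : space K) (X A : set (point E)) :=
  A = X `&` zclosure A.

Definition zconnected (K : fieldType) (E : space K) (X : set (point E)) :=
  forall A B, zclosed_in X A -> zclosed_in X B ->
    A `|` B = X -> A `&` B = set0 -> A = set0 \/ B = set0.

(* Local ring at x of the subvariety X. *)
Definition germ (K : fieldType) (E : space K) (X : set (point E))
    (x : point E) : set (point E -> K) :=
  [set f | exists2 g, regular_at x g & forall y, X y -> f y = g y].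

Definition regular_on (K : fieldType) (E : space K) (X : set (point E))
    (f : point E -> K) :=
  forall x, X x -> germ X x f.

Definition morphism (K : fieldType) (E E' : space K)
    (X : set (point E)) (Y : set (point E')) (h : point E -> point E') :=
  (forall x, X x -> Y (h x)) /\
  (forall x, X x -> forall f, germ Y (h x) f -> germ X x (f \o h)).

Definition functional (K : fieldType) (E : Type) := (E -> K) -> K.

(* Point derivations of the local ring of X at x.  Such a delta only depends
   on the restriction to X of its argument: apply the Leibniz rule to the
   indicator function of X.  For X included in Y, a tangent vector to X is
   literally a tangent vector to Y. *)
Definition tangent (K : fieldType) (E : space K) (X : set (point E))
    (x : point E) (delta : functional K (point E)) :=
  (forall c f g, germ X x f -> germ X x g ->
    delta (fun y => c * f y + g y) = c * delta f + delta g) /\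
  (forall f g, germ X x f -> germ X x g ->
    delta (fun y => f y * g y) = f x * delta g + g x * delta f).

(* Equality in T_x X, including membership of both sides. *)
Definition eq_tangent (K : fieldType) (E : space K) (X : set (point E))
    (x : point E) (delta delta' : functional K (point E)) :=
  [/\ tangent X x delta, tangent X x delta' &
      forall f, germ X x f -> delta f = delta' f].

Definition differential (K : fieldType) (E E' : Type) (h : E -> E')
    (delta : functional K E) : functional K E' :=
  fun f => delta (f \o h).

(* The vector e_j of the standard basis of K^l = T_z K^l. *)
Definition is_coordinate_vector (K : fieldType) (l : nat) (z : 'rV[K]_l)
    (j : 'I_l) (delta : functional K 'rV[K]_l) :=
  tangent (E := affine 'rV[K]_l) setT z delta /\
  forall i, delta (fun c => c 0 i) = (i == j)%:R.

Notation Mat K N := (affine 'M[K]_N).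

Definition subgroup (K : fieldType) (N : nat) (H : set 'M[K]_N) :=
  [/\ forall g, H g -> g \in unitmx, H 1%:M,
      forall g h, H g -> H h -> H (g *m h) & forall g, H g -> H (invmx g)].

Definition alg_group (K : fieldType) (N : nat) (H : set 'M[K]_N) :=
  subgroup H /\ zclosed_in (E := Mat K N) [set g | g \in unitmx] H.

Definition connected_group (K : fieldType) (N : nat) (H : set 'M[K]_N) :=
  alg_group H /\ zconnected (E := Mat K N) H.

Definition group_morphism (K : fieldType) (N M : nat)
    (H : set 'M[K]_N) (H' : set 'M[K]_M) (h : 'M[K]_N -> 'M[K]_M) :=
  morphism (E := Mat K N) (E' := Mat K M) H H' h /\
  (forall x y, H x -> H y -> h (x *m y) = h x *m h y).

Definition normal_in (K : fieldType) (N : nat) (H G : set 'M[K]_N) :=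
  H `<=` G /\ forall g h, G g -> H h -> H (g *m h *m invmx g).

Definition generated (K : fieldType) (N : nat) (A : set 'M[K]_N) :
    set 'M[K]_N :=
  [set g | forall H, subgroup H -> A `<=` H -> H g].

Definition derived (K : fieldType) (N : nat) (H : set 'M[K]_N) :
    set 'M[K]_N :=
  generated [set g | exists x y,
    [/\ H x, H y & g = x *m y *m invmx x *m invmx y]].

Definition solvable_group (K : fieldType) (N : nat) (H : set 'M[K]_N) :=
  exists n, iter n (@derived K N) H `<=` [set 1%:M].

Definition semisimple (K : fieldType) (N : nat) (G : set 'M[K]_N) :=
  connected_group G /\
  forall H, connected_group H -> normal_in H G -> solvable_group H ->
    H = [set 1%:M].

Definition adjoint_type (K : fieldType) (N : nat) (G : set 'M[K]_N) :=
  forall g, G g -> (forall h, G h -> g *m h = h *m g) -> g = 1%:M.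

Definition diagonal_group (K : fieldType) (d : nat) : set 'M[K]_d :=
  [set g | exists r : 'rV[K]_d, (forall i, r 0 i != 0) /\ g = diag_mx r].

(* T is isomorphic to (G_m)^d. *)
Definition torus (K : fieldType) (N d : nat) (T : set 'M[K]_N) :=
  alg_group T /\
  exists (f : 'M[K]_N -> 'M[K]_d) (g : 'M[K]_d -> 'M[K]_N),
    [/\ group_morphism T (@diagonal_group K d) f,
        group_morphism (@diagonal_group K d) T g,
        forall x, T x -> g (f x) = x &
        forall y, @diagonal_group K d y -> f (g y) = y].

Definition maximal_torus (K : fieldType) (N d : nat) (T G : set 'M[K]_N) :=
  [/\ torus d T, T `<=` G &
      forall d' T', torus d' T' -> T' `<=` G -> T `<=` T' -> T' = T].

Definition borel (K : fieldType) (N : nat) (B G : set 'M[K]_N) :=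
  [/\ connected_group B, solvable_group B, B `<=` G &
      forall B', connected_group B' -> solvable_group B' -> B' `<=` G ->
        B `<=` B' -> B' = B].

Definition unipotent (K : fieldType) (N : nat) (H : set 'M[K]_N) :=
  forall g, H g -> (g - 1%:M) ^+ N = 0.

Definition unipotent_radical (K : fieldType) (N : nat) (U B : set 'M[K]_N) :=
  [/\ connected_group U, normal_in U B, unipotent U &
      forall U', connected_group U' -> normal_in U' B -> unipotent U' ->
        U' `<=` U].

(* The last clause says that G carries the structure of the quotient of Gt by
   the kernel of pi; it is automatic in characteristic 0. *)
Definition isogeny (K : fieldType) (M N : nat)
    (Gt : set 'M[K]_M) (G : set 'M[K]_N) (pi : 'M[K]_M -> 'M[K]_N) :=
  [/\ group_morphism Gt G pi,
      forall g, G g -> exists2 x, Gt x & pi x = g,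
      finite_set [set x | Gt x /\ pi x = 1%:M] &
      forall g f, G g ->
        (forall x, Gt x -> pi x = g -> germ (E := Mat K M) Gt x (f \o pi)) ->
        germ (E := Mat K N) G g f].

Definition simply_connected (K : fieldType) (M : nat) (Gt : set 'M[K]_M) :=
  forall (P : nat) (H : set 'M[K]_P) (p : 'M[K]_P -> 'M[K]_M),
    connected_group H -> isogeny H Gt p ->
    forall x y, H x -> H y -> p x = p y -> x = y.

Definition universal_cover (K : fieldType) (M N : nat)
    (Gt : set 'M[K]_M) (G : set 'M[K]_N) (pi : 'M[K]_M -> 'M[K]_N) :=
  [/\ connected_group Gt, simply_connected Gt & isogeny Gt G pi].

Definition Lie (K : fieldType) (N : nat) (H : set 'M[K]_N) :
    set (functional K 'M[K]_N) :=
  tangent (E := Mat K N) H 1%:M.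

Definition eq_Lie (K : fieldType) (N : nat) (H : set 'M[K]_N) :
    functional K 'M[K]_N -> functional K 'M[K]_N -> Prop :=
  eq_tangent (E := Mat K N) H 1%:M.

Definition nonzero_Lie (K : fieldType) (N : nat) (H : set 'M[K]_N)
    (delta : functional K 'M[K]_N) :=
  exists2 f, germ (E := Mat K N) H 1%:M f & delta f != 0.

(* Commutator of the convolution product, i.e. the commutator of the
   left-invariant vector fields f |-> (x |-> delta (y |-> f (x y))). *)
Definition bracket (K : fieldType) (N : nat)
    (d1 d2 : functional K 'M[K]_N) : functional K 'M[K]_N :=
  fun f => d1 (fun x => d2 (fun y => f (x *m y)))
         - d2 (fun x => d1 (fun y => f (x *m y))).

Definition Ad (K : fieldType) (N : nat) (t : 'M[K]_N) :
    functional K 'M[K]_N -> functional K 'M[K]_N :=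
  differential (fun x => t *m x *m invmx t).

(* Two functions agreeing on T are the same character of T. *)
Definition is_character (K : fieldType) (N : nat) (T : set 'M[K]_N)
    (chi : 'M[K]_N -> K) :=
  [/\ regular_on (E := Mat K N) T chi, chi 1%:M = 1 &
      forall s t, T s -> T t -> chi (s *m t) = chi s * chi t].

(* <tau, chi> = d chi (tau), for tau in Lie T. *)
Definition pairing (K : fieldType) (N : nat)
    (tau : functional K 'M[K]_N) (chi : 'M[K]_N -> K) : K := tau chi.

Definition root_space (K : fieldType) (N : nat) (G T : set 'M[K]_N)
    (alpha : 'M[K]_N -> K) : set (functional K 'M[K]_N) :=
  [set delta | Lie G delta /\ forall t, T t ->
    eq_Lie G (Ad t delta) (fun f => alpha t * delta f)].

(* Roots of T whose root space meets (hence lies in) Lie B. *)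
Definition positive_root (K : fieldType) (N : nat) (G T B : set 'M[K]_N)
    (alpha : 'M[K]_N -> K) :=
  [/\ is_character T alpha, exists2 t, T t & alpha t != 1 &
      exists delta, [/\ Lie B delta, root_space G T alpha delta &
                        nonzero_Lie G delta]].

(* The base of the root system contained in the positive roots. *)
Definition simple_roots (K : fieldType) (N l : nat) (G T B : set 'M[K]_N)
    (alpha : 'I_l -> 'M[K]_N -> K) :=
  [/\ forall i, positive_root G T B (alpha i),
      forall c : 'I_l -> int,
        (forall t, T t -> \prod_i (alpha i t) ^ (c i) = 1) ->
        forall i, c i = 0 &
      forall beta, positive_root G T B beta ->
        exists m : 'I_l -> nat,
          forall t, T t -> beta t = \prod_i (alpha i t) ^+ m i].

Definition sl2_triple (K : fieldType) (N : nat) (G : set 'M[K]_N)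
    (x y h : functional K 'M[K]_N) :=
  [/\ eq_Lie G (bracket x y) h,
      eq_Lie G (bracket h x) (fun f => 2%:R * x f) &
      eq_Lie G (bracket h y) (fun f => - (2%:R * y f))].

(* The natural number whose image in K is c, if there is one. *)
Definition natval (K : fieldType) (c : K) : nat :=
  xget 0%N [set m : nat | c = m%:R].

Definition representation (K : fieldType) (M : nat) (V : vectType K)
    (Gt : set 'M[K]_M) (rho : 'M[K]_M -> 'End(V)) :=
  [/\ morphism (E := Mat K M) (E' := affine 'End(V)) Gt setT rho,
      rho 1%:M = \1%VF &
      forall x y, Gt x -> Gt y -> rho (x *m y) = (rho x \o rho y)%VF].

Definition irreducible (K : fieldType) (M : nat) (V : vectType K)
    (Gt : set 'M[K]_M) (rho : 'M[K]_M -> 'End(V)) :=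
  forall U : {vspace V}, (forall g, Gt g -> (rho g @: U <= U)%VS) ->
    U = 0%VS \/ U = fullv.

Section Wonderful.
Context (K : fieldType) (M N l n : nat) (V : vectType K).
Context (Gt : set 'M[K]_M) (G : set 'M[K]_N) (pi : 'M[K]_M -> 'M[K]_N).
Context (rho : 'M[K]_M -> 'End(V)).

Definition lift (g : 'M[K]_N) : 'M[K]_M :=
  xget 1%:M [set x | Gt x /\ pi x = g].

Definition psi (g : 'M[K]_N) : {vspace 'End(V)} := <[rho (lift g)]>%VS.

Definition Gbar : set {vspace 'End(V)} :=
  zclosure (E := projective 'End(V)) (psi @` G).

(* [g z h], for z in P(End V). *)
Definition biaction (g : 'M[K]_N) (z : {vspace 'End(V)}) (h : 'M[K]_N) :
    {vspace 'End(V)} :=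
  <[(rho (lift g) \o (vpick z \o rho (lift h)))%VF]>%VS.

Definition Lmap (z : {vspace 'End(V)}) (g : 'M[K]_N) := biaction 1%:M z g.
Definition Rmap (z : {vspace 'End(V)}) (g : 'M[K]_N) := biaction g z 1%:M.

Definition dL (z : {vspace 'End(V)}) := differential (K := K) (Lmap z).
Definition dR (z : {vspace 'End(V)}) := differential (K := K) (Rmap z).

Definition Amap (um up : 'M[K]_N) (z : {vspace 'End(V)}) :=
  biaction um z (invmx up).

Context (v : n.+1.-tuple V) (nn : 'I_n.+1 -> 'I_l -> nat).

Definition phi (k : 'I_n.+1) : 'End(V) :=
  linfun (fun w : V => coord v k w *: tnth v k).

(* With nn 0 = 0 and nn i = e_i for 1 <= i <= l, the first terms of the sum
   are phi_0 + \sum_i z_i phi_i. *)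
Definition Fmap (z : 'rV[K]_l) : {vspace 'End(V)} :=
  <[\sum_(k < n.+1) (\prod_(i < l) z 0 i ^+ nn k i) *: phi k]>%VS.

(* Differential at (e, e, z) of A o (id x id x F) on the direct sum of
   Lie U^-, Lie U^+ and T_z K^l = K^l: the sum of the three partial
   differentials. *)
Definition dA (z : 'rV[K]_l) (y x : functional K 'M[K]_N)
    (c : functional K 'rV[K]_l) : functional K {vspace 'End(V)} :=
  fun f =>
    differential (fun u => Amap u 1%:M (Fmap z)) y f +
    differential (fun u => Amap 1%:M u (Fmap z)) x f +
    differential (fun z' => Amap 1%:M 1%:M (Fmap z')) c f.

End Wonderful.

Definition zero_functional (K : fieldType) (E : Type) : functional K E :=
  fun _ => 0.

(* Main.v *)
(* Write V in the weight basis.  A lift to Gt of an element of G is determined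
   up to a scalar, since the kernel of pi acts diagonally with constant weight;
   so the entries of rho(g), divided by the (0,0) entry, are functions on G,
   regular at 1.  If delta in Lie G has weight gamma = sum_i m_i alpha_i, then
   conjugation by T and the independence of the alpha_i show that delta kills
   the (p,q) entry unless n_{iq} = n_{ip} + m_i for all i.  As F(z) is the line
   of the diagonal matrix with entries z^{n_k}, the derivatives of g |-> F(z) g
   and g |-> g F(z) along delta differ by the factor z^m, which gives the
   formulas for the root vectors.  The elements of T act by
   F(z) t = t F(z) = F(z_1 alpha_1(t)^-1, ..., z_l alpha_l(t)^-1), which gives
   the formulas for the coroots. *)
From HB Require Import structures.
Require Import Defs.
From mathcomp Require Import all_boot all_order all_algebra.
From mathcomp Require Import complex mpoly.
From mathcomp Require Import boolp classical_sets functions cardinality reals.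
Import Order.TTheory GRing.Theory Num.Theory.
Local Open Scope ring_scope.
Local Open Scope classical_set_scope.

Set Implicit Arguments.
Unset Strict Implicit.
Unset Printing Implicit Defensive.

(** * Regular functions and point derivations *)

Section Spaces.
Import Defs.
Context (K : fieldType).

(** A [space] carries no axioms. These closure properties are what the calculus of germs and
    derivations rests on, and isolating them lets it serve affine and projective spaces alike. *)
Definition regular_ring (E : space K) := forall x : point E,
  [/\ forall c : K, regular_at x (fun=> c),
      forall c f g, regular_at x f -> regular_at x g ->
        regular_at x (fun y => c * f y + g y) &
      forall f g, regular_at x f -> regular_at x g ->
        regular_at x (fun y => f y * g y)].

Lemma peval_ring (W : vectType K) :
  [/\ forall c (w : W), peval c%:MP w = c,
      forall p q (w : W), peval (p + q) w = peval p w + peval q w,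
      forall p q (w : W), peval (p * q) w = peval p w * peval q w &
      forall c p (w : W), peval (c *: p) w = c * peval p w].
Proof.
by split=> *; rewrite /peval ?mevalC ?mevalD ?mevalM ?mevalZ.
Qed.

Lemma affine_regular_ring (W : vectType K) : regular_ring (affine W).
Proof.
have [pC pD pM pZ] := peval_ring W.
move=> x; split=> [c|c f g [a [b [bx fE]]] [a' [b' [bx' gE]]]
                    |f g [a [b [bx fE]]] [a' [b' [bx' gE]]]] /=.
- by exists c%:MP, 1%:MP; rewrite pC oner_neq0; split=> // v _; rewrite !pC divr1.
- exists (c *: (a * b') + a' * b), (b * b'); rewrite pM mulf_neq0//.
  split=> // v; rewrite pM mulf_eq0 negb_or => /andP[bv bv'].
  by rewrite fE// gE// pD pZ !pM mulrA addf_div// mulrA.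
- exists (a * a'), (b * b'); rewrite pM mulf_neq0//.
  split=> // v; rewrite pM mulf_eq0 negb_or => /andP[bv bv'].
  by rewrite fE// gE// pM mulf_div.
Qed.

Lemma projective_regular_ring (W : vectType K) : regular_ring (projective W).
Proof.
have [pC pD pM pZ] := peval_ring W.
move=> x; split=> [c|c f g [d [a [b [da db bx fE]]]] [d' [a' [b' [da' db' bx' gE]]]]
   |f g [d [a [b [da db bx fE]]]] [d' [a' [b' [da' db' bx' gE]]]]] /=.
- exists 0%N, c%:MP, 1%:MP; split=> [| | |v _ _]; rewrite ?pC ?oner_neq0 ?divr1 //.
  + by rewrite -(mulr1 c%:MP) mul_mpolyC; apply/dhomogZ/dhomog1.
  + exact: dhomog1.
- exists (d + d')%N, (c *: (a * b') + a' * b), (b * b'); split.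
  + apply: dhomogD; first by apply/dhomogZ/dhomogM.
    by rewrite addnC; apply: dhomogM.
  + exact: dhomogM.
  + by rewrite pM mulf_neq0.
  + move=> v v0; rewrite pM mulf_eq0 negb_or => /andP[bv bv'].
    by rewrite fE// gE// pD pZ !pM mulrA addf_div// mulrA.
- exists (d + d')%N, (a * a'), (b * b'); split; try exact: dhomogM.
  + by rewrite pM mulf_neq0.
  + move=> v v0; rewrite pM mulf_eq0 negb_or => /andP[bv bv'].
    by rewrite fE// gE// pM mulf_div.
Qed.

Section Tangent.
Context (E : space K) (Er : regular_ring E) (X : set (point E)) (x : point E).

Lemma germ_cst c : germ X x (fun=> c).
Proof. by exists (fun=> c) => //; have [+ _ _] := Er x; apply. Qed.

Lemma germ_lin c f g : germ X x f -> germ X x g ->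
  germ X x (fun y => c * f y + g y).
Proof.
move=> [f' rf ff'] [g' rg gg']; exists (fun y => c * f' y + g' y).
  by have [_ + _] := Er x; apply.
by move=> y Xy; rewrite ff'// gg'.
Qed.

Lemma germ_mul f g : germ X x f -> germ X x g -> germ X x (fun y => f y * g y).
Proof.
move=> [f' rf ff'] [g' rg gg']; exists (fun y => f' y * g' y).
  by have [_ _ +] := Er x; apply.
by move=> y Xy; rewrite ff'// gg'.
Qed.

Lemma germ_eq f g : germ X x f -> (forall y, X y -> g y = f y) -> germ X x g.
Proof.
by move=> [f' rf ff'] fg; exists f' => // y Xy; rewrite fg// ff'.
Qed.

Lemma germ_sub (Y : set (point E)) f : X `<=` Y -> germ Y x f -> germ X x f.
Proof. by move=> XY [f' rf ff']; exists f' => // y /XY /ff'. Qed.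

Lemma germ_add f g : germ X x f -> germ X x g -> germ X x (fun y => f y + g y).
Proof.
by move=> gf gg; apply: germ_eq (germ_lin 1 gf gg) _ => y _; rewrite mul1r.
Qed.

Lemma germ_scale c f : germ X x f -> germ X x (fun y => c * f y).
Proof. by move=> gf; apply/germ_mul/gf/germ_cst. Qed.

Lemma germ_sum (I : Type) (s : seq I) (F : I -> point E -> K) :
  (forall i, germ X x (F i)) -> germ X x (fun y => \sum_(i <- s) F i y).
Proof.
move=> gF; elim: s => [|i s IH].
  by apply: germ_eq (germ_cst 0) _ => y _; rewrite big_nil.
by apply: germ_eq (germ_add (gF i) IH) _ => y _; rewrite big_cons.
Qed.

Lemma germ_prod (I : Type) (s : seq I) (F : I -> point E -> K) :
  (forall i, germ X x (F i)) -> germ X x (fun y => \prod_(i <- s) F i y).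
Proof.
move=> gF; elim: s => [|i s IH].
  by apply: germ_eq (germ_cst 1) _ => y _; rewrite big_nil.
by apply: germ_eq (germ_mul (gF i) IH) _ => y _; rewrite big_cons.
Qed.

Lemma germ_exp n f : germ X x f -> germ X x (fun y => f y ^+ n).
Proof.
move=> gf; elim: n => [|n IH]; first exact: germ_cst.
by apply: germ_eq (germ_mul gf IH) _ => y _; rewrite exprS.
Qed.

Lemma tangent_sub (Y : set (point E)) delta : X `<=` Y ->
  tangent X x delta -> tangent Y x delta.
Proof.
move=> XY [dl dm].
by split=> [c|] f g gf gg; [apply: dl|apply: dm]; apply: germ_sub XY _.
Qed.

Section Derivation.
Context (delta : functional K (point E)) (hd : tangent X x delta).

Lemma tangent0 : delta (fun=> 0) = 0.
Proof.
have := hd.1 (-1) _ _ (germ_cst 0) (germ_cst 0).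
by rewrite mulr0 addr0 mulN1r addNr => ->.
Qed.

Lemma tangentZ c f : germ X x f -> delta (fun y => c * f y) = c * delta f.
Proof.
move=> gf; have := hd.1 c _ _ gf (germ_cst 0); rewrite tangent0 addr0 => <-.
by congr delta; apply: funext => y; rewrite addr0.
Qed.

Lemma tangentD f g : germ X x f -> germ X x g ->
  delta (fun y => f y + g y) = delta f + delta g.
Proof.
move=> gf gg; have := hd.1 1 _ _ gf gg; rewrite mul1r => <-.
by congr delta; apply: funext => y; rewrite mul1r.
Qed.

Lemma tangent_sum (I : Type) (s : seq I) (F : I -> point E -> K) :
  (forall i, germ X x (F i)) ->
  delta (fun y => \sum_(i <- s) F i y) = \sum_(i <- s) delta (F i).
Proof.
move=> gF; elim: s => [|i s IH].
  rewrite big_nil; apply: etrans tangent0; congr delta.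
  by apply: funext => y; rewrite big_nil.
rewrite big_cons -IH -tangentD//; last exact: germ_sum.
by congr delta; apply: funext => y; rewrite big_cons.
Qed.

Lemma tangent_cst c : delta (fun=> c) = 0.
Proof.
have d1 : delta (fun=> 1) = 0.
  have := hd.2 _ _ (germ_cst 1) (germ_cst 1).
  rewrite mulr1 mul1r => /eqP; rewrite -subr_eq0 opprD addNKr oppr_eq0.
  by move/eqP.
have := tangentZ c (germ_cst 1); rewrite d1 mulr0 => <-.
by congr delta; apply: funext => y; rewrite mulr1.
Qed.

(** The Leibniz rule for [u * f = u * g], with [u] equal to [s] on [X], leaves
    [s x * delta f = s x * delta g], because [f x = g x]. Identities valid only on a neighbourhood
    may thus be differentiated. *)
Lemma tangent_local s f g : X x -> germ X x s -> s x != 0 ->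
  germ X x f -> germ X x g -> (forall y, X y -> s y != 0 -> f y = g y) ->
  delta f = delta g.
Proof.
move=> Xx gs sx gf gg fg.
(* u vanishes off X, where f and g are unrelated. *)
pose u y := if pselect (X y) then s y else 0.
have uX y : X y -> u y = s y by rewrite /u; case: pselect.
have gu : germ X x u by apply: germ_eq gs _.
have := hd.2 _ _ gu gf.
have -> : (fun y => u y * f y) = (fun y => u y * g y).
  apply: funext => y; rewrite /u; case: pselect => Xy; last by rewrite !mul0r.
  by have [->|/(fg _ Xy)->] := eqVneq (s y) 0; rewrite ?mul0r.
rewrite hd.2// (fg _ Xx sx) => /addIr; rewrite uX// => /(mulfI sx).
by move=> ->.
Qed.

Lemma tangent_eq f g : X x -> germ X x f -> (forall y, X y -> f y = g y) ->
  delta f = delta g.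
Proof.
move=> Xx gf fg; apply: (@tangent_local (fun=> 1)) => // [|||y Xy _].
- exact: germ_cst.
- exact: oner_neq0.
- by apply: germ_eq gf _ => y /fg.
- exact: fg.
Qed.

(** Germs are closed under the ring operations, so the derivation laws pass from [delta] to
    [delta']; only values on germs remain to be compared. *)
Lemma eq_tangent_germ delta' :
  (forall f, germ X x f -> delta f = delta' f) -> eq_tangent X x delta delta'.
Proof.
move=> e; split=> //; split=> [c|] f g gf gg.
  by rewrite -!e ?hd.1//; apply: germ_lin.
by rewrite -!e ?hd.2//; apply: germ_mul.
Qed.

Lemma tangent_exp n f : germ X x f ->
  delta (fun y => f y ^+ n) = n%:R * f x ^+ n.-1 * delta f.
Proof.
move=> gf; elim: n => [|n IH]; first by rewrite tangent_cst !mul0r.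
have -> : (fun y => f y ^+ n.+1) = (fun y => f y * f y ^+ n).
  by apply: funext => y; rewrite exprS.
rewrite hd.2//; last exact: germ_exp.
rewrite IH /= -[in RHS]natr1 mulrDl mulrDl mul1r; congr (_ + _).
by case: n {IH} => [|n]; rewrite ?mul0r ?mulr0// exprS /= !mulrA [f x * _]mulrC.
Qed.

End Derivation.
End Tangent.

Lemma tangent_differential (E E' : space K) (X : set (point E))
    (Y : set (point E')) (x : point E) (y : point E') (h : point E -> point E')
    (delta : functional K (point E)) :
  h x = y -> (forall f, germ Y y f -> germ X x (f \o h)) ->
  tangent X x delta -> tangent Y y (differential h delta).
Proof.
move=> <- gh hd; split=> [c|] f g /gh gf /gh gg; rewrite /differential.
  by rewrite -hd.1.
by rewrite -hd.2.
Qed.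

End Spaces.

(** * Calculus on affine spaces *)

Section AffineGerms.
Import Defs.
Context (K : fieldType) (W : vectType K) (X : set W) (x : W).
Local Notation germX := (germ (E := affine W) X x).

Lemma affine_germP f : germX f <-> exists a b : {mpoly K[\dim {:W}]},
  peval b x != 0 /\
  forall v, X v -> peval b v != 0 -> f v = peval a v / peval b v.
Proof.
split=> [[f' [a [b [bx fE]]] ff']|[a [b [bx fE]]]].
  by exists a, b; split=> // v Xv bv; rewrite ff'// fE.
(* Values of [f] off [X] are arbitrary, so the ambient representative takes the fraction there. *)
exists (fun v => if pselect (X v) then f v else peval a v / peval b v).
  by exists a, b; split=> // v bv; case: pselect => // Xv; rewrite fE.
by move=> v Xv; case: pselect.
Qed.

Lemma germ_inv f : X x -> germX f -> f x != 0 -> germX (fun y => (f y)^-1).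
Proof.
have [_ _ pM _] := peval_ring W.
move=> Xx /affine_germP[a [b [bx fE]]] fx; apply/affine_germP.
(* Writing [b / a] with denominator [a * b] confines it to points where [a / b] represents [f]. *)
exists (b * b), (a * b); split=> [|v Xv].
  move: fx; rewrite fE// mulf_eq0 invr_eq0 negb_or => /andP[ax _].
  by rewrite pM mulf_neq0.
rewrite !pM mulf_eq0 negb_or => /andP[av bv]; rewrite fE//.
by rewrite invf_div -mulf_div divff// mulr1.
Qed.

Lemma germ_local s f f' : X x -> germX s -> s x != 0 -> germX f' ->
  (forall y, X y -> s y != 0 -> f y = f' y) -> germX f.
Proof.
have [_ _ pM _] := peval_ring W.
move=> Xx /affine_germP[c [d [dx sE]]] sx /affine_germP[a [b [bx f'E]]] ff'.
(* With [s = c / d], the common factor [c * d] restricts [a / b] to points where [s] is defined and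
   nonzero. *)
apply/affine_germP; exists (a * (c * d)), (b * (c * d)); split=> [|v Xv].
  move: sx; rewrite sE// mulf_eq0 invr_eq0 negb_or => /andP[cx _].
  by rewrite !pM !mulf_neq0.
rewrite !pM !mulf_eq0 !negb_or => /and3P[bv cv dv].
rewrite ff' ?f'E ?sE ?mulf_neq0 ?invr_eq0//.
by rewrite -mulf_div divff ?mulr1 ?mulf_neq0.
Qed.

Lemma germ_linear f : (forall c u v, f (c *: u + v) = c * f u + f v) -> germX f.
Proof.
move=> fl; have [pC pD pM pZ] := peval_ring W.
have f0 : f 0 = 0.
  by have := fl (-1) 0 0; rewrite scaler0 addr0 mulN1r addNr.
pose p : {mpoly K[\dim {:W}]} := \sum_(i < \dim {:W}) f (vbasis {:W})`_i *: 'X_i.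
have pE v : peval p v = f v.
  rewrite [in RHS](coord_vbasis (memvf v)).
  have fD : {morph f : u v / u + v}.
    by move=> u v'; rewrite -{1}(scale1r u) fl mul1r.
  rewrite (big_morph f fD f0) /peval /p raddf_sum /=.
  apply: eq_bigr => k _.
  by rewrite -[X in _ = f X]addr0 fl f0 addr0 mevalZ mevalXU mulrC.
apply/affine_germP; exists p, 1%:MP; rewrite pC oner_neq0; split=> // v _ _.
by rewrite pC divr1 pE.
Qed.

End AffineGerms.

(** * The chain rule in the coordinates of a frame *)

Section ChainRule.
Import Defs.
Context (K : fieldType) (W : vectType K) (I : finType).
Context (g : I -> W -> K) (u : I -> W).
Context (frame : forall w, w = \sum_i g i w *: u i).

(* D depends neither on r nor on delta: this compares the derivatives of f
   along different maps to W. *)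
Definition has_gradient (w : W) (f : W -> K) (D : I -> K) :=
  forall (W' : vectType K) (X : set W') (x : W') (r : W' -> W),
    r x = w -> X x -> (forall i, germ (E := affine W') X x (g i \o r)) ->
    germ (E := affine W') X x (f \o r) /\
    forall delta, tangent (E := affine W') X x delta ->
      delta (f \o r) = \sum_i D i * delta (g i \o r).

Lemma gradient_cst w c : has_gradient w (fun=> c) (fun=> 0).
Proof.
move=> W' X x r rx Xx gr; split=> [|delta hd].
  exact/germ_cst/affine_regular_ring.
rewrite (tangent_cst (@affine_regular_ring _ W') hd).
by rewrite big1// => i _; rewrite mul0r.
Qed.

Lemma gradient_lin w c f f' D D' : has_gradient w f D -> has_gradient w f' D' ->
  has_gradient w (fun v => c * f v + f' v) (fun i => c * D i + D' i).
Proof.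
move=> hf hf' W' X x r rx Xx gr.
have [gf df] := hf _ _ _ _ rx Xx gr; have [gf' df'] := hf' _ _ _ _ rx Xx gr.
split=> [|delta hd]; first exact: (germ_lin (@affine_regular_ring _ W') c gf gf').
have /= -> := hd.1 c _ _ gf gf'.
rewrite df// df'// big_distrr -big_split; apply: eq_bigr => i _ /=.
by rewrite mulrDl mulrA.
Qed.

Lemma gradient_mul w f f' D D' : has_gradient w f D -> has_gradient w f' D' ->
  has_gradient w (fun v => f v * f' v) (fun i => f w * D' i + f' w * D i).
Proof.
move=> hf hf' W' X x r rx Xx gr.
have [gf df] := hf _ _ _ _ rx Xx gr; have [gf' df'] := hf' _ _ _ _ rx Xx gr.
split=> [|delta hd]; first exact: (germ_mul (@affine_regular_ring _ W') gf gf').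
have /= -> := hd.2 _ _ gf gf'.
rewrite rx df// df'// !big_distrr -big_split; apply: eq_bigr => i _ /=.
by rewrite mulrDl !mulrA.
Qed.

Lemma gradient_frame w i : has_gradient w (g i) (fun j => (j == i)%:R).
Proof.
move=> W' X x r rx Xx gr; split=> [|delta _]; first exact: gr.
by rewrite (bigD1 i)//= eqxx mul1r big1 ?addr0// => j /negPf->; rewrite mul0r.
Qed.

(** Functions with a gradient contain the constants and the [g i] and are stable under linear
    combinations and products. By [frame], each [vbasis] coordinate is a linear combination of the
    [g i]. *)
Lemma gradient_peval w (p : {mpoly K[\dim {:W}]}) :
  exists D, has_gradient w (peval p) D.
Proof.
have [pC pD pM pZ] := peval_ring W.
pose P q := exists D, has_gradient w (peval q) D.
have PC c : P c%:MP.
  exists (fun=> 0); rewrite (_ : peval _ = fun=> c); first exact: gradient_cst.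
  by apply: funext => v; rewrite pC.
have PL c q q' : P q -> P q' -> P (c *: q + q').
  move=> [D hD] [D' hD']; eexists.
  rewrite (_ : peval _ = fun v => c * peval q v + peval q' v).
    exact: (gradient_lin c hD hD').
  by apply: funext => v; rewrite pD pZ.
have PM q q' : P q -> P q' -> P (q * q').
  move=> [D hD] [D' hD']; eexists.
  rewrite (_ : peval _ = fun v => peval q v * peval q' v).
    exact: gradient_mul hD hD'.
  by apply: funext => v; rewrite pM.
have PX k : P 'X_k.
  pose Q f := exists D, has_gradient w f D.
  rewrite /P (_ : peval _ =
      fun v => \sum_(i <- index_enum I) coord (vbasis {:W}) k (u i) * g i v); last first.
    apply: funext => v; rewrite /peval mevalXU [in LHS](frame v) linear_sum.
    by apply: eq_bigr => i _; rewrite linearZ mulrC.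
  elim: (index_enum I) => [|i s [D hD]].
    exists (fun=> 0); rewrite (_ : (fun v : W => _) = fun=> 0).
      exact: gradient_cst.
    by apply: funext => v; rewrite big_nil.
  eexists; rewrite (_ : (fun v : W => _) = fun v => coord (vbasis {:W}) k (u i) * g i v +
     \sum_(j <- s) coord (vbasis {:W}) k (u j) * g j v).
    exact: (gradient_lin _ (@gradient_frame w i) hD).
  by apply: funext => v; rewrite big_cons.
have P1 : P 1 by rewrite -mpolyC1.
suff : P p by [].
rewrite [p]mpolyE; elim/big_rec : _ => [|m q _ Pq]; first by rewrite -mpolyC0.
apply: PL Pq; rewrite mpolyXE_id; elim/big_ind : _ => // i _.
by elim: (m i) => [//|k IH]; rewrite exprS; apply: PM.
Qed.

Lemma chain_rule w f : regular_at (s := affine W) w f ->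
  exists D, has_gradient w f D.
Proof.
move=> [a [b [bw fE]]].
have [Da ha] := gradient_peval w a; have [Db hb] := gradient_peval w b.
(* The quotient rule, obtained by differentiating [f * b = a]. *)
exists (fun i => (peval b w)^-1 * (Da i - f w * Db i)).
move=> W' X x r rx Xx gr.
have R := @affine_regular_ring _ W'.
have [ga da] := ha _ _ _ _ rx Xx gr; have [gb db] := hb _ _ _ _ rx Xx gr.
have bx : (peval b \o r) x != 0 by rewrite /= rx.
have gf : germ (E := affine W') X x (f \o r).
  apply: germ_local Xx gb bx (germ_mul R ga (germ_inv Xx gb bx)) _ => y Xy by0.
  exact: fE.
split=> // delta hd.
(* The identity [f * b = a] is known only where [b] does not vanish, which suffices for a derivation
   at [x]. *)
have e : delta (fun y => (f \o r) y * (peval b \o r) y) = delta (peval a \o r).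
  apply: (tangent_local hd Xx gb bx (germ_mul R gf gb) ga) => y Xy by0 /=.
  by rewrite fE// divfK.
rewrite hd.2// in e; rewrite /= rx in e.
apply: (mulfI bw); rewrite -[LHS](addKr (f w * delta (peval b \o r))) e.
rewrite da// db// !big_distrr -sumrN -big_split; apply: eq_bigr => i _ /=.
by rewrite -!mulrA mulVKf// mulrBl addrC mulrA.
Qed.

End ChainRule.

(** * Matrix entries and the differential of inversion *)

Section Matrices.
Import Defs.
Context (K : fieldType) (N : nat).
Local Notation MK := (affine 'M[K]_N).
Local Notation ring := (@affine_regular_ring K 'M[K]_N).

Lemma matrix_frame (w : 'M[K]_N) :
  w = \sum_(p : 'I_N * 'I_N) w p.1 p.2 *: delta_mx p.1 p.2.
Proof. by rewrite {1}[w]matrix_sum_delta pair_big. Qed.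

Lemma germ_entry X x (i j : 'I_N) :
  germ (E := MK) X x (fun w : 'M[K]_N => w i j).
Proof. by apply: germ_linear => c u v; rewrite !mxE. Qed.

Lemma germ_det X x m (F : 'M[K]_N -> 'M[K]_m) :
  (forall i j, germ (E := MK) X x (fun w => F w i j)) ->
  germ (E := MK) X x (fun w => \det (F w)).
Proof.
move=> gF; apply: (germ_sum ring) => s; apply: (germ_scale ring).
exact: (germ_prod ring).
Qed.

Lemma germ_invmx X x (i j : 'I_N) : X x -> X `<=` [set w | w \in unitmx] ->
  germ (E := MK) X x (fun w => invmx w i j).
Proof.
move=> Xx Xu.
have gd : germ (E := MK) X x (fun w => (\det w)^-1).
  apply: germ_inv => //; last by have := Xu _ Xx; rewrite /= unitmxE unitfE.
  by apply: germ_det => *; apply: germ_entry.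
have gc : germ (E := MK) X x (fun w => cofactor w j i).
  apply: (germ_scale ring); apply: germ_det => a b.
  apply: germ_eq (germ_entry _ _ (fintype.lift j a) (fintype.lift i b)) _.
  by move=> w _; rewrite !mxE.
apply: germ_eq (germ_mul ring gd gc) _ => w Xw.
by rewrite /invmx (Xu _ Xw) !mxE.
Qed.

(** Differentiating the product of [w] and its inverse at the identity gives the sign for matrix
    entries; the chain rule extends it to every germ. *)
Lemma tangent_invmx (G : set 'M[K]_N) delta f :
  subgroup G -> Lie G delta -> germ (E := MK) G 1%:M f ->
  germ (E := MK) G 1%:M (f \o invmx) /\ delta (f \o invmx) = - delta f.
Proof.
move=> [Gu G1 GM GV] hd [f' rf ff'].
have Gu' : G `<=` [set w | w \in unitmx] by move=> w /Gu.
have [D hD] := chain_rule matrix_frame rf.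
have gi p : germ (E := MK) G 1%:M ((fun w : 'M[K]_N => w p.1 p.2) \o invmx).
  exact: germ_invmx.
have ge p : germ (E := MK) G 1%:M ((fun w : 'M[K]_N => w p.1 p.2) \o id).
  exact: germ_entry.
have [gfi dfi] := hD _ _ _ _ (invmx1 _ _) G1 gi.
have [gf df] := hD _ G _ id erefl G1 ge.
have gfi' : germ (E := MK) G 1%:M (f \o invmx).
  by apply: germ_eq gfi _ => w /GV/ff'.
split=> //.
rewrite (tangent_eq ring hd G1 gfi' (g := f' \o invmx)); last by move=> w /GV/ff'.
rewrite (tangent_eq ring hd G1 (germ_eq gf ff') (g := f' \o id)) ?dfi ?df//.
rewrite -sumrN; apply: eq_bigr => -[i j] _; rewrite -mulrN; congr (_ * _) => /=.
have ggi k : germ (E := MK) G 1%:M (fun w => w i k * invmx w k j).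
  refine (germ_mul ring (ge (i, k)) (gi (k, j))).
(* The sum is constant on [G]. Under the Leibniz rule at the identity, only [k = i] contributes a
   derivative of the inverse and only [k = j] one of [w]. *)
have : delta (fun w => \sum_k w i k * invmx w k j) = 0.
  rewrite -[RHS](tangent_cst ring hd ((i == j)%:R)).
  apply: (tangent_eq ring hd G1) => [|w /Gu wu]; first exact: (germ_sum ring).
  by have := mulmxV wu => /matrixP/(_ i j); rewrite !mxE.
rewrite (tangent_sum ring hd)//.
under eq_bigr => k _ do
  rewrite (hd.2 _ _ (ge (i, k)) (gi (k, j))) /= invmx1 !mxE.
rewrite big_split /= (bigD1 i)//= big1 => [|k /negPf]; last first.
  by rewrite eq_sym => ->; rewrite mul0r.
rewrite [X in _ + X](bigD1 j)//= [X in _ + (_ + X)]big1 => [|k /negPf->]; last first.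
  by rewrite mul0r.
by rewrite !eqxx !mul1r !addr0 => /eqP; rewrite addr_eq0 => /eqP.
Qed.

End Matrices.

(** * Pullback of functions from projective space to vectors *)

Section Lines.
Import Defs.
Context (K : fieldType) (W : vectType K).

Lemma lineZ (k : K) (w : W) : k != 0 -> (<[k *: w]> = <[w]>)%VS.
Proof.
move=> k0; apply/eqP; rewrite eqEsubv -!memvE memvZ ?memv_line//=.
by apply/vlineP; exists k^-1; rewrite scalerA mulVf ?scale1r.
Qed.

Lemma vpick_line (w : W) : w != 0 -> exists2 k, k != 0 & vpick <[w]> = k *: w.
Proof.
move=> w0; have /vlineP[k kE] := memv_pick <[w]>%VS.
exists k => //; apply/eqP => k0; move/eqP: kE.
by rewrite k0 scale0r vpick0 -dimv_eq0 dim_vline w0.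
Qed.

Lemma peval_homog d (b : {mpoly K[\dim {:W}]}) k (w : W) :
  b \is d.-homog -> peval b (k *: w) = k ^+ d * peval b w.
Proof.
move=> /dhomogP hb; rewrite /peval !mevalE big_distrr big_seq [in RHS]big_seq.
apply: eq_bigr => m /hb /= md; rewrite mulrCA; congr (_ * _).
rewrite -md mdegE -prodrXr -big_split; apply: eq_bigr => i _ /=.
by rewrite linearZ exprMn.
Qed.

(** Homogeneity transfers nonvanishing of the denominator from the arbitrary generator [vpick] to
    [w0]. *)
Lemma line_regular (w0 : W) f : w0 != 0 ->
  regular_at (s := projective W) <[w0]>%VS f ->
  regular_at (s := affine W) w0 (fun w => f <[w]>%VS).
Proof.
have [_ _ pM _] := peval_ring W.
move=> w00 [d [a [b [ha hb bw fE]]]].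
have [k k0 kE] := vpick_line w00.
have [i ci] : exists i, coord (vbasis {:W}) i w0 != 0.
  apply: contrapT => /forallNP c0; move/eqP: w00; apply.
  rewrite (coord_vbasis (memvf w0)) big1// => i _.
  by have /negP := c0 i; rewrite negbK => /eqP->; rewrite scale0r.
(* The fraction describes [f] only on nonzero vectors; a coordinate that is nonzero at [w0], put
   into the denominator, excludes [v = 0]. *)
exists (a * 'X_i), (b * 'X_i); split=> [|v].
  move: bw; rewrite kE (peval_homog _ _ hb) mulf_eq0 negb_or => /andP[_ bw].
  by rewrite pM mulf_neq0// /peval mevalXU.
rewrite !pM mulf_eq0 negb_or => /andP[bv Xv].
rewrite -mulf_div divff// mulr1 fE//.
by apply: contraNneq Xv => ->; rewrite /peval mevalXU linear0.
Qed.

End Lines.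

(** * Characters of a torus *)

Section Characters.
Import Defs.
Context (K : fieldType) (N : nat) (T : set 'M[K]_N).
Context (hT : subgroup T).

Lemma characterV chi t : is_character T chi -> T t ->
  chi t != 0 /\ chi (invmx t) = (chi t)^-1.
Proof.
have [Tu T1 TM TV] := hT.
move=> [_ chi1 chiM] Tt.
have e : chi t * chi (invmx t) = 1.
  by rewrite -chiM ?mulmxV ?chi1 //; [exact: Tu|exact: TV].
have c0 : chi t != 0.
  by apply: contra_eq_neq e => ->; rewrite mul0r eq_sym oner_neq0.
by split=> //; apply: (mulfI c0); rewrite e divff//.
Qed.

(** Artin's argument: subtracting [chi j u] times the relation at [x] from the relation at [x *m u]
    eliminates [chi j]. The shorter relation has coefficients [c i * (chi i u - chi j u)], with [u]
    chosen to separate [i] from [j]. *)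
Lemma characters_free (I : eqType) (s : seq I) (chi : I -> 'M[K]_N -> K) c :
  (forall i, chi i 1%:M = 1) ->
  (forall i x y, T x -> T y -> chi i (x *m y) = chi i x * chi i y) ->
  (forall i j, i != j -> exists2 x, T x & chi i x != chi j x) ->
  uniq s -> (forall x, T x -> \sum_(i <- s) c i * chi i x = 0) ->
  forall i, i \in s -> c i = 0.
Proof.
have [Tu T1 TM TV] := hT.
move=> chi1 chiM chiN; elim: s c => [//|j s IH] c /= /andP[js us] cs.
have c0 i : i \in s -> c i = 0.
  move=> si; have ij : i != j by apply: contraNneq js => <-.
  have [u Tx ne] := chiN _ _ ij.
  suff /eqP : c i * (chi i u - chi j u) = 0.
    by rewrite mulf_eq0 subr_eq0 (negPf ne) orbF => /eqP.
  apply: (IH (fun i => c i * (chi i u - chi j u))) => // x Tx'.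
  have := cs _ (TM _ _ Tx Tx'); rewrite big_cons chiM// => e1.
  have := cs _ Tx'; rewrite big_cons => /(congr1 ( *%R (chi j u))).
  rewrite mulr0 => e2; have := congr2 (fun a b => a - b) e1 e2.
  rewrite [RHS]subrr => e; apply: (etrans _ e) => /=.
  rewrite [chi j u * (_ + _)]mulrDr [chi j u * (c j * _)]mulrCA.
  rewrite opprD addrACA subrr add0r big_distrr -sumrB /=.
  apply: eq_bigr => k _.
  by rewrite chiM// mulrBr mulrBl -!mulrA [chi j u * (_ * _)]mulrCA.
move=> i; rewrite inE => /orP[/eqP->|/c0//].
have := cs _ T1; rewrite big_cons chi1 mulr1 big_seq big1 ?addr0// => k /c0->.
by rewrite mul0r.
Qed.

(** Monomials in the inverses of the [alpha i] are characters of [T], distinct by multiplicative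
    independence, so the coefficients of [p] form a trivial relation. Geometrically, the image of
    [T] in the affine space of dimension [l] is Zariski dense. *)
Lemma torus_dense l (alpha : 'I_l -> 'M[K]_N -> K) (p : {mpoly K[l]}) :
  (forall i, is_character T (alpha i)) ->
  (forall c : 'I_l -> int,
     (forall t, T t -> \prod_i (alpha i t) ^ (c i) = 1) -> forall i, c i = 0) ->
  (forall t, T t -> p.@[fun i => (alpha i t)^-1] = 0) -> p = 0.
Proof.
have [Tu T1 TM TV] := hT.
move=> ha hind p0.
suff c0 m : m \in msupp p -> p@_m = 0.
  by apply/mpolyP => m; rewrite mcoeff0;
    have [/c0//|/memN_msupp_eq0] := boolP (m \in msupp p).
apply: (@characters_free _ (msupp p) (fun m t => \prod_i (alpha i t)^-1 ^+ m i)
  (fun m => p@_m)) => [i|i x y Tx Ty|i j ij||x Tx].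
- by apply: big1 => k _; have [_ -> _] := ha k; rewrite invr1 expr1n.
- rewrite -big_split; apply: eq_bigr => k _ /=.
  by have [_ _ ->] := ha k; rewrite // invfM exprMn.
- apply: contrapT => eij; move/eqP: ij; apply; apply/mnmP => k.
  have := hind (fun k => (i k)%:Z - (j k)%:Z) _ k.
  move=> H; apply/eqP; rewrite -eqz_nat -subr_eq0; apply/eqP/H => t Tt.
  have {eij} : \prod_k (alpha k t)^-1 ^+ i k = \prod_k (alpha k t)^-1 ^+ j k.
    by apply: contrapT => /eqP ne; apply: eij; exists t.
  under eq_bigr do rewrite exprVn; under [in RHS]eq_bigr do rewrite exprVn.
  rewrite !prodfV => /invr_inj e.
  have a0 k' : alpha k' t != 0 by case: (characterV (ha k') Tt).
  rewrite (eq_bigr (fun k => alpha k t ^+ i k / alpha k t ^+ j k)); last first.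
    by move=> k' _; rewrite expfzDr// exprnN.
  by rewrite big_split /= prodfV e divff//; apply/prodf_neq0 => k' _; apply: expf_neq0.
- exact: msupp_uniq.
- by rewrite -mevalE p0.
Qed.

End Characters.

(** * The action of G on the closure of psi(G) *)

Section Entries.
Import Defs.
Context (K : fieldType) (n l : nat) (V : vectType K) (v : n.+1.-tuple V).
Context (nn : 'I_n.+1 -> 'I_l -> nat).
Context (hv : basis_of fullv v).

Definition entry (p : 'I_n.+1 * 'I_n.+1) (w : 'End(V)) : K :=
  coord v p.1 (w (tnth v p.2)).

(** The elementary operator sending [v_j] to [v_i] for [p = (i, j)], named so that it can carry a
    linear structure. *)
Definition rank1_fun (p : 'I_n.+1 * 'I_n.+1) (u : V) : V :=
  coord v p.2 u *: tnth v p.1.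

Lemma rank1_fun_linear p : linear (rank1_fun p).
Proof. by move=> c x y; rewrite /rank1_fun linearP scalerDl scalerA. Qed.

HB.instance Definition _ p :=
  GRing.isLinear.Build K V V _ (rank1_fun p) (rank1_fun_linear p).

Definition rank1 p : 'End(V) := linfun (rank1_fun p).

Lemma coordE i j : coord v i (tnth v j) = (i == j)%:R.
Proof. by rewrite (tnth_nth 0) coord_free ?(basis_free hv)// eq_sym. Qed.

Lemma decomp u : u = \sum_i coord v i u *: tnth v i.
Proof.
rewrite {1}(coord_basis hv (memvf u)); apply: eq_bigr => i _.
by rewrite (tnth_nth 0).
Qed.

Lemma entry_lin p c w w' : entry p (c *: w + w') = c * entry p w + entry p w'.
Proof. by rewrite /entry add_lfunE scale_lfunE linearP. Qed.

Lemma entryZ p c w : entry p (c *: w) = c * entry p w.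
Proof. by rewrite /entry scale_lfunE linearZ. Qed.

Lemma entry1 p : entry p \1%VF = (p.1 == p.2)%:R.
Proof. by rewrite /entry id_lfunE coordE. Qed.

Lemma entry_frame (w : 'End(V)) : w = \sum_p entry p w *: rank1 p.
Proof.
apply/lfunP => u; rewrite sum_lfunE (decomp (w u)).
rewrite (eq_bigr (fun p : 'I_n.+1 * 'I_n.+1 =>
  (entry (p.1, p.2) w * coord v p.2 u) *: tnth v p.1)); last first.
  by move=> p _; rewrite scale_lfunE lfunE /= /rank1_fun scalerA -surjective_pairing.
rewrite -(pair_bigA _ (fun i j => (entry (i, j) w * coord v j u) *: tnth v i)).
apply: eq_bigr => i _; rewrite -scaler_suml {1}(decomp u) !linear_sum.
by congr (_ *: _); apply: eq_bigr => j _; rewrite /entry !linearZ mulrC.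
Qed.

Definition monom (c : 'rV[K]_l) k := \prod_(i < l) c 0 i ^+ nn k i.

(** The diagonal operator that spans the line [Fmap v nn c]. *)
Definition Phi (c : 'rV[K]_l) : 'End(V) := \sum_k monom c k *: phi v k.

Lemma PhiE c u : Phi c u = \sum_k (monom c k * coord v k u) *: tnth v k.
Proof.
rewrite sum_lfunE; apply: eq_bigr => k _.
(* [phi v k] is convertible to [rank1 (k, k)], through which the linear structure is found. *)
by rewrite scale_lfunE (lfunE (rank1_fun (k, k))) /= /rank1_fun scalerA.
Qed.

Lemma coord_Phi c i u : coord v i (Phi c u) = monom c i * coord v i u.
Proof.
rewrite PhiE linear_sum (bigD1 i)//= big1 => [|j /negPf ij];
  by rewrite linearZ /= coordE ?eqxx ?mulr1 ?addr0// eq_sym ij mulr0.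
Qed.

Lemma Phi_basis c j : Phi c (tnth v j) = monom c j *: tnth v j.
Proof.
rewrite PhiE (bigD1 j)//= big1 => [|i /negPf ij];
  by rewrite coordE ?eqxx ?mulr1 ?addr0// ij mulr0 scale0r.
Qed.

Lemma entry_Phi_comp p c w : entry p (Phi c \o w)%VF = monom c p.1 * entry p w.
Proof. by rewrite /entry comp_lfunE coord_Phi. Qed.

Lemma entry_comp_Phi p c w : entry p (w \o Phi c)%VF = monom c p.2 * entry p w.
Proof. by rewrite /entry comp_lfunE Phi_basis !linearZ. Qed.

Lemma entry_Phi p c : entry p (Phi c) = monom c p.1 * (p.1 == p.2)%:R.
Proof. by rewrite -entry1 -entry_Phi_comp comp_lfun1r. Qed.

Lemma germ_entry_Phi X c p :
  germ (E := affine 'rV[K]_l) X c (fun c' => entry p (Phi c')).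
Proof.
have R := @affine_regular_ring K 'rV[K]_l.
have gm : germ (E := affine 'rV[K]_l) X c
    (fun c' => (p.1 == p.2)%:R * monom c' p.1).
  apply: (germ_scale R); apply: (germ_prod R) => i; apply: (germ_exp R).
  by apply: germ_linear => k u w; rewrite !mxE.
apply: germ_eq gm _.
by move=> c' _; rewrite entry_Phi mulrC.
Qed.

End Entries.

(** * Lifts to the covering group and points of the closure *)

Section Cover.
Import Defs.
Context (K : fieldType) (M N l n : nat) (G T : set 'M[K]_N).
Context (alpha : 'I_l -> 'M[K]_N -> K) (Gt : set 'M[K]_M) (pi : 'M[K]_M -> 'M[K]_N).
Context (V : vectType K) (rho : 'M[K]_M -> 'End(V)) (lam : 'M[K]_M -> K).
Context (v : n.+1.-tuple V) (nn : 'I_n.+1 -> 'I_l -> nat).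
Local Notation Tt := [set t | Gt t /\ T (pi t)].
Context (hG : subgroup G).
Context (hT : subgroup T).
Context (hTG : T `<=` G).
Context (hGt : subgroup Gt).
Context (hpi : isogeny Gt G pi).
Context (hrho : representation Gt rho).
Context (hlam : is_character Tt lam).
Context (halpha : forall i, is_character T (alpha i)).
Context (hind : forall c : 'I_l -> int,
  (forall t, T t -> \prod_i (alpha i t) ^ (c i) = 1) -> forall i, c i = 0).
Context (hv : basis_of fullv v).
Context (hwt : forall k t, Gt t -> T (pi t) ->
  rho t (tnth v k) =
    (lam t * \prod_(i < l) (alpha i (pi t)) ^- nn k i) *: tnth v k).
Context (hn0 : forall i, nn ord0 i = 0%N).

Local Notation lft := (lift Gt pi).
Local Notation Gb := (Gbar Gt G pi rho).
Local Notation ent := (entry v).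
Local Notation Ph := (Phi v nn).
Local Notation mon := (monom nn).
Local Notation p00 := (@ord0 n, @ord0 n).

Lemma pi_G x : Gt x -> G (pi x).
Proof. by case: hpi => -[[+ _] _] _ _ _; apply. Qed.

Lemma piM x y : Gt x -> Gt y -> pi (x *m y) = pi x *m pi y.
Proof. by case: hpi => -[_ +] _ _ _; apply. Qed.

Lemma pi1 : pi 1%:M = 1%:M.
Proof.
have [_ Gt1 _ _] := hGt; have [Gu _ _ _] := hG.
have u := Gu _ (pi_G Gt1).
have := piM Gt1 Gt1; rewrite mulmx1 => /(congr1 (mulmx (invmx (pi 1%:M)))).
by rewrite mulmxA mulVmx// mul1mx.
Qed.

Lemma piV x : Gt x -> pi (invmx x) = invmx (pi x).
Proof.
have [Gtu Gt1 _ GtV] := hGt; have [Gu _ _ _] := hG => Gx.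
have := piM (GtV _ Gx) Gx; rewrite mulVmx ?Gtu// pi1.
move/(congr1 (mulmx^~ (invmx (pi x)))).
by rewrite mul1mx -mulmxA mulmxV ?mulmx1 ?Gu//; exact: pi_G.
Qed.

Lemma Tt_subgroup : subgroup Tt.
Proof.
have [Gtu Gt1 GtM GtV] := hGt; have [_ T1 TM TV] := hT.
split=> [g [/Gtu]|//|g h [Gg Tg] [Gh Th]|g [Gg Tg]]//=.
- by rewrite pi1.
- by rewrite piM//; split; [apply: GtM|apply: TM].
- by rewrite piV//; split; [apply: GtV|apply: TV].
Qed.

Lemma lift_spec g : G g -> Gt (lft g) /\ pi (lft g) = g.
Proof.
case: hpi => _ surj _ _ /surj[x Gx xg].
rewrite /lift; case: xgetP => [y -> //|/(_ x)]; by case.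
Qed.

Lemma rho_eq (u w : 'End(V)) : (forall k, u (tnth v k) = w (tnth v k)) -> u = w.
Proof.
move=> e; apply/lfunP => x; rewrite (decomp hv x) !linear_sum.
by apply: eq_bigr => i _; rewrite !linearZ /= e.
Qed.

Lemma rhoM x y : Gt x -> Gt y -> rho (x *m y) = (rho x \o rho y)%VF.
Proof. by case: hrho => _ _; apply. Qed.

Lemma rho_neq0 x : Gt x -> rho x != 0.
Proof.
have [Gtu Gt1 GtM GtV] := hGt; have [_ r1 _] := hrho => Gx.
apply/eqP => e; have := rhoM Gx (GtV _ Gx).
rewrite mulmxV ?Gtu// r1 e comp_lfun0l => /(congr1 (ent p00)).
by rewrite entry1// eqxx /entry lfunE /= linear0 => /eqP; rewrite oner_eq0.
Qed.

(** Two lifts differ by an element of the kernel of [pi]. There every [alpha i] takes the value 1,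
    so [lam] alone remains in the weight formula of each basis vector. *)
Lemma lift_scalar x : Gt x -> exists2 c, c != 0 & rho x = c *: rho (lft (pi x)).
Proof.
have [Gtu Gt1 GtM GtV] := hGt; have [Gu _ _ _] := hG => Gx.
have [Gy pyx] := lift_spec (pi_G Gx); set y := lft (pi x) in Gy pyx *.
have Gk : Gt (x *m invmx y) by apply/GtM/GtV.
have pk : pi (x *m invmx y) = 1%:M.
  rewrite piM//; last exact: GtV.
  by rewrite piV// pyx mulmxV// Gu//; apply: pi_G.
have [_ T1 _ _] := hT.
have Tk : T (pi (x *m invmx y)) by rewrite pk.
exists (lam (x *m invmx y)).
  by case: (characterV Tt_subgroup hlam (conj Gk Tk)).
rewrite -{1}[x](mulmxKV (Gtu _ Gy)) rhoM// -[X in _ = _ *: X]comp_lfun1l comp_lfunZl.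
congr (_ \o _)%VF; apply: rho_eq => k; rewrite hwt// pk scale_lfunE id_lfunE.
rewrite big1 ?mulr1// => i _.
by have [_ -> _] := halpha i; rewrite expr1n invr1.
Qed.

Lemma rho_lift1 : exists2 c, c != 0 & rho (lft 1%:M) = c *: \1%VF.
Proof.
have [_ Gt1 _ _] := hGt; have [c c0] := lift_scalar Gt1.
have [_ -> _] := hrho; rewrite pi1 => e.
exists c^-1; rewrite ?invr_neq0// e scalerA mulVf// scale1r //.
Qed.

Lemma comp_rho_neq0 g h (w : 'End(V)) : G g -> G h -> w != 0 ->
  (rho (lft g) \o (w \o rho (lft h)))%VF != 0.
Proof.
move=> Gg Gh; apply: contra_neq => e.
have [Gtu Gt1 GtM GtV] := hGt; have [_ r1 _] := hrho.
have [Gx _] := lift_spec Gg; have [Gy _] := lift_spec Gh.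
have := congr1 (fun w => (rho (invmx (lft g)) \o (w \o rho (invmx (lft h))))%VF) e.
rewrite /= comp_lfun0l comp_lfun0r !comp_lfunA -rhoM//; last exact: GtV.
rewrite -!comp_lfunA -rhoM//; last exact: GtV.
by rewrite mulmxV ?mulVmx ?Gtu// r1 comp_lfun1l comp_lfun1r.
Qed.

Lemma psi_eq x : Gt x -> <[rho x]>%VS = psi Gt pi rho (pi x).
Proof. by move=> /lift_scalar[c c0 ->]; rewrite lineZ. Qed.

Lemma rho_T t : Gt t -> T (pi t) ->
  rho t = lam t *: Ph (\row_i (alpha i (pi t))^-1).
Proof.
move=> Gx Tx; apply: rho_eq => k; rewrite hwt// scale_lfunE Phi_basis// scalerA.
congr ((_ * _) *: _); apply: eq_bigr => i _.
by rewrite mxE exprVn.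
Qed.

Lemma Phi_neq0 c : Ph c != 0.
Proof.
apply/eqP => e; have := entry_Phi nn hv p00 c; rewrite e /monom big1 => [|i _].
  by rewrite eqxx mulr1 /entry lfunE /= linear0 => /eqP; rewrite eq_sym oner_eq0.
by rewrite hn0.
Qed.

(** Linear coordinates of the composite are combinations of the monomials with exponents [nn j]; [P]
    is [p] with these polynomials substituted. *)
Lemma peval_Phi (A B : 'End(V)) (p : {mpoly K[\dim {:'End(V)}]}) :
  exists P : {mpoly K[l]}, forall c : 'rV[K]_l,
    peval p (A \o (Ph c \o B))%VF = P.@[fun i => c 0 i].
Proof.
pose q := [tuple \sum_j coord (vbasis {:'End(V)}) k (A \o (phi v j \o B))%VF *:
            'X_[[multinom nn j i | i < l]] : {mpoly K[l]} | k < \dim {:'End(V)}].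
exists (p \mPo q) => c; rewrite comp_mpoly_meval; apply: meval_eq => k.
rewrite tnth_mktuple.
have -> : (A \o (Ph c \o B) = \sum_j mon c j *: (A \o (phi v j \o B)))%VF.
  apply/lfunP => u; rewrite sum_lfunE !comp_lfunE sum_lfunE linear_sum.
  apply: eq_bigr => j _; rewrite !scale_lfunE linearZ /=.
  by rewrite !comp_lfunE.
rewrite linear_sum raddf_sum; apply: eq_bigr => j _ /=.
rewrite linearZ mevalZ mevalX mulrC; congr (_ * _).
by apply: eq_bigr => i _; rewrite mnmE.
Qed.

(* A polynomial function of c vanishing at c_i = alpha_i(t)^-1 for all t in T
   is zero. *)
Lemma in_Gbar g h c : G g -> G h ->
  Gb <[(rho (lft g) \o (Ph c \o rho (lft h)))%VF]>%VS.
Proof.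
have [_ _ pM _] := peval_ring 'End(V).
move=> Gg Gh f rf f0; have [Gx xg] := lift_spec Gg; have [Gy yh] := lift_spec Gh.
have w0 := comp_rho_neq0 Gg Gh (Phi_neq0 c).
have [a [b [bw fE]]] := line_regular w0 rf.
(* The product [a * b] is used because [f = a / b] gives no information at torus points where [b]
   vanishes, while the product is zero there as well. *)
have [P PE] := peval_Phi (rho (lft g)) (rho (lft h)) (a * b).
have P0 : P = 0.
  apply: (torus_dense hT halpha hind) => t Tt.
  have [Gz zt] := lift_spec (hTG Tt).
  rewrite (_ : P.@[_] = P.@[fun i => (\row_i (alpha i t)^-1) 0 i]); last first.
    by apply: meval_eq => i; rewrite mxE.
  rewrite -PE pM; set w := (_ \o _)%VF.
  have [->|bw0] := eqVneq (peval b w) 0; first by rewrite mulr0.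
  suff /eqP : peval a w / peval b w = 0.
    by rewrite mulf_eq0 invr_eq0 (negPf bw0) orbF => /eqP->; rewrite mul0r.
  (* On [T], [rho] of the lift is a nonzero multiple of [Ph] at the inverses of the [alpha i t], so
     this line is [psi] of [g *m t *m h]. *)
  rewrite -fE//; apply: f0; exists (g *m t *m h).
    have [_ _ GM _] := hG; apply: (GM _ _ _ Gh); apply: GM => //; exact: hTG.
  have [_ _ GtM _] := hGt; rewrite -xg -zt -yh -!piM//; last exact: GtM.
  rewrite -psi_eq; last by apply: (GtM _ _ _ Gy); apply: GtM.
  have Tz : T (pi (lft t)) by rewrite zt.
  have [lz _] := characterV Tt_subgroup hlam (conj Gz Tz).
  rewrite !rhoM//; last exact: GtM.
  rewrite (rho_T Gz Tz) zt -comp_lfunZr -comp_lfunZl lineZ//.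
  by rewrite /w comp_lfunA.
have := PE c; rewrite P0 meval0 pM => /eqP; rewrite mulf_eq0 (negPf bw) orbF.
by move=> /eqP a0; rewrite fE// a0 mul0r.
Qed.

Lemma Fmap_Gbar c : Gb (Fmap v nn c).
Proof.
have [_ G1 _ _] := hG; have := in_Gbar (c := c) G1 G1.
have [k k0 ->] := rho_lift1.
rewrite -comp_lfunZl -comp_lfunZr -comp_lfunZr comp_lfun1l comp_lfun1r.
by rewrite !lineZ.
Qed.

Lemma biaction_Phi g h c : G g -> G h ->
  biaction Gt pi rho g (Fmap v nn c) h =
  <[(rho (lft g) \o (Ph c \o rho (lft h)))%VF]>%VS.
Proof.
move=> Gg Gh; rewrite /biaction /Fmap; have [k k0 ->] := vpick_line (Phi_neq0 c).
by rewrite -comp_lfunZl -comp_lfunZr lineZ.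
Qed.

Lemma Lmap_Phi g c : G g ->
  Lmap Gt pi rho (Fmap v nn c) g = <[(Ph c \o rho (lft g))%VF]>%VS.
Proof.
have [_ G1 _ _] := hG; move=> Gg; rewrite /Lmap biaction_Phi//.
by have [k k0 ->] := rho_lift1; rewrite -comp_lfunZl comp_lfun1l lineZ.
Qed.

Lemma Rmap_Phi g c : G g ->
  Rmap Gt pi rho (Fmap v nn c) g = <[(rho (lft g) \o Ph c)%VF]>%VS.
Proof.
have [_ G1 _ _] := hG; move=> Gg; rewrite /Rmap biaction_Phi//.
by have [k k0 ->] := rho_lift1; rewrite -!comp_lfunZr comp_lfun1r lineZ.
Qed.

(** * Normalised matrix entries as functions on [G] *)

Definition rr p g := ent p (rho (lft g)) / ent p00 (rho (lft g)).

(** The scalar relating two lifts cancels in the quotient, so any lift computes [rr]. *)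
Lemma rrE p x : Gt x -> rr p (pi x) = ent p (rho x) / ent p00 (rho x).
Proof.
move=> /lift_scalar[c c0 ->]; rewrite !entryZ -mulf_div divff ?mul1r//.
Qed.

Lemma rr1 p : rr p 1%:M = (p.1 == p.2)%:R.
Proof.
have [_ Gt1 _ _] := hGt; have [_ r1 _] := hrho.
by rewrite -pi1 rrE// r1 !entry1// eqxx divr1.
Qed.

(** The last clause of [isogeny] reduces regularity to the points over 1. There [rho] is a nonzero
    scalar, so the (0,0) entry is invertible. *)
Lemma germ_rr p : germ (E := Mat K N) G 1%:M (rr p).
Proof.
case: hpi => _ _ _; apply; first by case: hG.
move=> x Gx px.
have [[_ rg] r1 _] := hrho.
have gr : germ (E := Mat K M) Gt x ((fun w => ent p w / ent p00 w) \o rho).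
  apply: rg => //.
  have R := @affine_regular_ring K 'End(V).
  apply: (germ_mul R); first by apply: germ_linear => *; apply: entry_lin.
  apply: germ_inv => //; first by apply: germ_linear => *; apply: entry_lin.
  have [c c0 ->] := lift_scalar Gx; rewrite px.
  have [d d0 ->] := rho_lift1.
  by rewrite !entryZ !mulf_neq0// entry1// eqxx oner_neq0.
by apply: germ_eq gr _ => y Gy /=; rewrite rrE.
Qed.

(* Near 1 on G, a lift of g is a multiple of [\sum_p rr p g *: rank1 p]. *)
Lemma projective_gradient c f : germ (E := projective 'End(V)) Gb (Fmap v nn c) f ->
  exists D : 'I_n.+1 * 'I_n.+1 -> K,
  germ (E := affine 'rV[K]_l) setT c (f \o Fmap v nn) /\
  forall (q : 'End(V) -> 'End(V)) (mu : 'I_n.+1 * 'I_n.+1 -> K) P,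
    (forall w p, ent p (q w) = mu p * ent p w) -> q \1%VF = Ph c ->
    (forall g, G g -> P g = <[q (rho (lft g))]>%VS /\ Gb (P g)) ->
    germ (E := Mat K N) G 1%:M (f \o P) /\
    forall delta, Lie G delta ->
      delta (f \o P) = \sum_p D p * (mu p * delta (rr p)).
Proof.
move=> [f' rf' ff'].
have rF := line_regular (Phi_neq0 c) rf'.
have [D hD] := chain_rule (entry_frame hv) rF.
have [_ G1 _ _] := hG.
have R := @affine_regular_ring K 'M[K]_N.
exists D; split=> [|q mu P hq q1 hP].
  have [gF _] := hD _ setT c Ph erefl I (germ_entry_Phi nn hv setT c).
  by apply: germ_eq gF _ => c' _; rewrite /= ff'//; apply: Fmap_Gbar.
(* A representative of [P g] normalised by the (0,0) entry of the lift. Its entries are germs,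
   whereas the choice of lift need not be regular. *)
pose r g := q ((ent p00 (rho (lft g)))^-1 *: rho (lft g)).
have entr p g : ent p (r g) = mu p * rr p g by rewrite hq entryZ /rr [_^-1 * _]mulrC.
have r1 : r 1%:M = Ph c.
  rewrite -q1 /r; congr q; have [k k0 ->] := rho_lift1.
  by rewrite entryZ entry1// eqxx mulr1 scalerA mulVf// scale1r.
have gr p : germ (E := Mat K N) G 1%:M (ent p \o r).
  by apply: germ_eq (germ_scale R (mu p) (germ_rr p)) _ => g _ /=.
have [gF dF] := hD _ _ _ _ r1 G1 gr.
(* Since division by zero gives 0, [rr p00] is 1 where the (0,0) entry is nonzero and 0 elsewhere:
   it marks where [r] represents [P]. *)
have s1 : rr p00 1%:M != 0 by rewrite rr1 eqxx oner_neq0.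
have e g : G g -> rr p00 g != 0 -> (f \o P) g = f' <[r g]>%VS.
  move=> Gg; rewrite mulf_eq0 negb_or => /andP[e0 _].
  have [Pg GP] := hP _ Gg; rewrite /= ff'// Pg; congr f'.
  have -> : q (rho (lft g)) = ent p00 (rho (lft g)) *: r g.
    rewrite (entry_frame hv (q _)) (entry_frame hv (r g)) scaler_sumr.
    by apply: eq_bigr => p _; rewrite scalerA entr hq /rr mulrCA [_ / _]mulrC mulVKf.
  by rewrite lineZ.
have gP : germ (E := Mat K N) G 1%:M (f \o P).
  exact: germ_local G1 (germ_rr _) s1 gF e.
split=> // delta hd.
rewrite (tangent_local hd G1 (germ_rr _) s1 gP gF e) dF//.
apply: eq_bigr => p _; congr (_ * _).
rewrite -(tangentZ R hd)//; last exact: germ_rr.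
by congr delta; apply: funext => g; rewrite /= entr.
Qed.

(** * Derivatives of the left and right translations *)

Local Notation Lz zz := (Lmap Gt pi rho (Fmap v nn zz)).
Local Notation Rz zz := (Rmap Gt pi rho (Fmap v nn zz)).

Lemma Lmap_hyps zz :
  [/\ forall w p, ent p (Ph zz \o w)%VF = mon zz p.1 * ent p w,
      (Ph zz \o \1)%VF = Ph zz &
      forall g, G g -> Lz zz g = <[(Ph zz \o rho (lft g))%VF]>%VS /\ Gb (Lz zz g)].
Proof.
have [_ G1 _ _] := hG; split=> [w p||g Gg]; first exact: entry_Phi_comp.
  exact: comp_lfun1r.
by rewrite Lmap_Phi//; split=> //; rewrite -Lmap_Phi// /Lmap biaction_Phi//;
  apply: in_Gbar.
Qed.

Lemma Rmap_hyps zz :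
  [/\ forall w p, ent p (w \o Ph zz)%VF = mon zz p.2 * ent p w,
      (\1 \o Ph zz)%VF = Ph zz &
      forall g, G g -> Rz zz g = <[(rho (lft g) \o Ph zz)%VF]>%VS /\ Gb (Rz zz g)].
Proof.
have [_ G1 _ _] := hG; split=> [w p||g Gg]; first exact: entry_comp_Phi.
  exact: comp_lfun1l.
by rewrite Rmap_Phi//; split=> //; rewrite -Rmap_Phi// /Rmap biaction_Phi//;
  apply: in_Gbar.
Qed.

(** Both translations are represented by maps through the same operator [Ph zz], so one gradient [D]
    serves both; only the row or column factor [mon zz] differs. *)
Lemma biaction_gradient zz f :
  germ (E := projective 'End(V)) Gb (Fmap v nn zz) f ->
  [/\ germ (E := affine 'rV[K]_l) setT zz (f \o Fmap v nn),
      germ (E := Mat K N) G 1%:M (f \o Lz zz),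
      germ (E := Mat K N) G 1%:M (f \o Rz zz) &
      exists D : 'I_n.+1 * 'I_n.+1 -> K, forall delta, Lie G delta ->
      delta (f \o Lz zz) = \sum_p D p * (mon zz p.1 * delta (rr p)) /\
      delta (f \o Rz zz) = \sum_p D p * (mon zz p.2 * delta (rr p))].
Proof.
move=> /projective_gradient[D [gF hD]].
have [L1 L2 L3] := Lmap_hyps zz; have [R1 R2 R3] := Rmap_hyps zz.
have [gL dL'] := hD (fun w => Ph zz \o w)%VF _ _ L1 L2 L3.
have [gR dR'] := hD (fun w => w \o Ph zz)%VF _ _ R1 R2 R3.
split=> //; exists D => delta hd; split; [exact: dL'|exact: dR'].
Qed.

Lemma biaction1 z : biaction Gt pi rho 1%:M (Fmap v nn z) 1%:M = Fmap v nn z.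
Proof.
have [_ G1 _ _] := hG; rewrite biaction_Phi//; have [k k0 ->] := rho_lift1.
by rewrite -comp_lfunZl -!comp_lfunZr comp_lfun1l comp_lfun1r !lineZ.
Qed.

Lemma tangent_dL zz delta : Lie G delta ->
  tangent (E := projective 'End(V)) Gb (Fmap v nn zz) (differential (Lz zz) delta).
Proof.
move=> hd; apply: (tangent_differential (E := Mat K N) _ _ hd).
  exact: biaction1.
by move=> f /biaction_gradient[].
Qed.

Lemma tangent_dR zz delta : Lie G delta ->
  tangent (E := projective 'End(V)) Gb (Fmap v nn zz) (differential (Rz zz) delta).
Proof.
move=> hd; apply: (tangent_differential (E := Mat K N) _ _ hd).
  exact: biaction1.
by move=> f /biaction_gradient[].
Qed.

(** * Weights of the matrix entries and root vectors *)

Local Notation tau t := (\row_i (alpha i t)^-1).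

(** The values of [lam] at a lift and at its inverse cancel, and the (0,0) entry is unchanged
    because the monomial of index 0 is 1. *)
Lemma rr_conj p t g : T t -> G g ->
  rr p (t *m g *m invmx t) = mon (tau t) p.1 / mon (tau t) p.2 * rr p g.
Proof.
have [Gtu Gt1 GtM GtV] := hGt; have [_ _ _ TV] := hT.
move=> Tt Gg; have [Gx xt] := lift_spec (hTG Tt); have [Gy yg] := lift_spec Gg.
have Gx' := GtV _ Gx.
have -> : t *m g *m invmx t = pi (lft t *m lft g *m invmx (lft t)).
  by rewrite (piM _ Gx') ?piM ?piV ?xt ?yg//; apply: GtM.
rewrite rrE; last by apply: (GtM _ _ _ Gx'); apply: GtM.
rewrite !rhoM//; last exact: GtM.
have Tx : T (pi (lft t)) by rewrite xt.
have Tx' : T (pi (invmx (lft t))) by rewrite piV//; apply: TV.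
have [l0 lV] := characterV Tt_subgroup hlam (conj Gx Tx).
rewrite (rho_T Gx Tx) (rho_T Gx' Tx') piV// xt lV.
have mV k : mon (tau (invmx t)) k = (mon (tau t) k)^-1.
  rewrite -prodfV; apply: eq_bigr => i _; rewrite !mxE.
  by have [_ ->] := characterV hT (halpha i) Tt; rewrite exprVn.
have m0 z : mon z ord0 = 1 by rewrite /monom big1// => i _; rewrite hn0.
rewrite -!comp_lfunZr -!comp_lfunZl !entryZ !entry_comp_Phi// !entry_Phi_comp//.
rewrite !mV /= !m0 invr1 !mul1r !(mulKf l0) /rr !mulrA.
by rewrite [_^-1 * mon _ _]mulrC.
Qed.

(** Along [Ad t], the derivative of [rr p] is scaled both by [chi t] and by the product of the
    [alpha i t] to the powers [nn p.2 i - nn p.1 i]. If it is nonzero, these characters agree, and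
    independence of the [alpha i] equates the exponents. *)
Lemma weight_entry chi (m : 'I_l -> int) delta p : root_space G T chi delta ->
  (forall t, T t -> chi t = \prod_i alpha i t ^ m i) ->
  delta (rr p) != 0 -> forall i, (nn p.2 i)%:Z = (nn p.1 i)%:Z + m i.
Proof.
move=> [hd hw] hchi d0 i; apply/eqP; rewrite -subr_eq0; apply/eqP.
apply: (hind (c := fun i => (nn p.2 i)%:Z - ((nn p.1 i)%:Z + m i))) => t Tt.
have [_ G1 _ _] := hG.
have R := @affine_regular_ring K 'M[K]_N.
have [_ _ /(_ _ (germ_rr p))] := hw t Tt.
rewrite hchi// /Ad /differential.
have e g : G g -> mon (tau t) p.1 / mon (tau t) p.2 * rr p g =
    (rr p \o (fun x => t *m x *m invmx t)) g.
  by move=> Gg /=; rewrite rr_conj.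
have := tangent_eq R hd G1 (germ_scale R _ (germ_rr p)) e.
rewrite (tangentZ R hd); last exact: germ_rr.
move=> <- /(mulIf d0) E.
have a0 k : alpha k t != 0 by case: (characterV hT (halpha k) Tt).
have monE k : mon (tau t) k = (\prod_j alpha j t ^+ nn k j)^-1.
  by rewrite -prodfV; apply: eq_bigr => j _; rewrite mxE exprVn.
rewrite (eq_bigr (fun k => alpha k t ^+ nn p.2 k /
  (alpha k t ^+ nn p.1 k * alpha k t ^ m k))); last first.
  move=> k _; apply: (mulIf (x := alpha k t ^ ((nn p.1 k)%:Z + m k))).
    exact: expfz_neq0.
  by rewrite -expfzDr// subrK expfzDr// divfK// mulf_neq0 ?expf_neq0 ?expfz_neq0.
rewrite big_split /= prodfV big_split /= -E !monE invrK.
by rewrite mulVKf ?divff//; apply/prodf_neq0 => k _; rewrite expf_neq0.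
Qed.

Lemma monom_shift (zz : 'rV[K]_l) (m : 'I_l -> nat) i j :
  (forall k, (nn j k)%:Z = (nn i k)%:Z + (m k)%:Z) ->
  mon zz j = \prod_k zz 0 k ^+ m k * mon zz i.
Proof.
move=> e; rewrite /monom -big_split; apply: eq_bigr => k _ /=.
by have := e k; rewrite -PoszD => -[->]; rewrite exprD mulrC.
Qed.

(** Term by term in the gradient: wherever [delta (rr p)] is nonzero, the column factor is the
    monomial with exponents [m] times the row factor. *)
Lemma positive_root_action beta (m : 'I_l -> nat) delta zz f :
  root_space G T beta delta ->
  (forall t, T t -> beta t = \prod_i alpha i t ^+ m i) ->
  germ (E := projective 'End(V)) Gb (Fmap v nn zz) f ->
  delta (f \o Rz zz) = \prod_i zz 0 i ^+ m i * delta (f \o Lz zz).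
Proof.
move=> hr hb /biaction_gradient[_ _ _ [D hD]].
have [-> ->] := hD _ hr.1; rewrite big_distrr; apply: eq_bigr => p _ /=.
have [->|d0] := eqVneq (delta (rr p)) 0; first by rewrite !mulr0.
have e := weight_entry (m := fun k => Posz (m k)) hr hb d0.
by rewrite (monom_shift _ e) [RHS]mulrCA !mulrA.
Qed.

(** The exponents are now [- m], which exchanges the roles of rows and columns. *)
Lemma negative_root_action beta (m : 'I_l -> nat) delta zz f :
  root_space G T (fun t => (beta t)^-1) delta ->
  (forall t, T t -> beta t = \prod_i alpha i t ^+ m i) ->
  germ (E := projective 'End(V)) Gb (Fmap v nn zz) f ->
  delta (f \o Lz zz) = \prod_i zz 0 i ^+ m i * delta (f \o Rz zz).
Proof.
move=> hr hb /biaction_gradient[_ _ _ [D hD]].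
have [-> ->] := hD _ hr.1; rewrite big_distrr; apply: eq_bigr => p _ /=.
have [->|d0] := eqVneq (delta (rr p)) 0; first by rewrite !mulr0.
have hb' t : T t -> (beta t)^-1 = \prod_i alpha i t ^ (- (m i)%:Z).
  by move=> Tt; rewrite hb// -prodfV; apply: eq_bigr => i _; rewrite exprnN.
have e k : (nn p.1 k)%:Z = (nn p.2 k)%:Z + (m k)%:Z.
  by rewrite (weight_entry hr hb' d0) subrK.
by rewrite (monom_shift _ e) [RHS]mulrCA !mulrA.
Qed.

(** * The partial differentials of [A] *)

Lemma dA_x zz delta f : Lie G delta ->
  germ (E := projective 'End(V)) Gb (Fmap v nn zz) f ->
  dA Gt pi rho v nn zz (@zero_functional K _) delta (@zero_functional K _) f =
  - delta (f \o Lz zz).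
Proof.
move=> hd /biaction_gradient[_ gL _ _].
rewrite /dA /differential /zero_functional add0r addr0.
(* The second argument of [Amap] enters through its inverse, hence the sign. *)
by have [_] := tangent_invmx hG hd gL.
Qed.

Lemma dA_y zz delta :
  dA Gt pi rho v nn zz delta (@zero_functional K _) (@zero_functional K _) =
  differential (Rz zz) delta.
Proof.
apply: funext => f; rewrite /dA /differential /zero_functional !addr0.
by rewrite /Amap invmx1.
Qed.

Lemma dA_e zz delta f :
  dA Gt pi rho v nn zz (@zero_functional K _) (@zero_functional K _) delta f =
  delta (f \o Fmap v nn).
Proof.
rewrite /dA /differential /zero_functional !add0r; congr delta.
by apply: funext => c; rewrite /Amap invmx1 /= biaction1.
Qed.

(** * The action of the torus and its derivative *)

Lemma biaction_T zz t : T t ->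
  Lz zz t = Fmap v nn (\row_j (zz 0 j / alpha j t)) /\
  Rz zz t = Fmap v nn (\row_j (zz 0 j / alpha j t)).
Proof.
move=> Tt; have [Gx xt] := lift_spec (hTG Tt).
have Tx : T (pi (lft t)) by rewrite xt.
have [l0 _] := characterV Tt_subgroup hlam (conj Gx Tx).
have mM k : mon (\row_j (zz 0 j / alpha j t)) k = mon zz k * mon (tau t) k.
  by rewrite -big_split; apply: eq_bigr => i _; rewrite !mxE exprMn.
rewrite Lmap_Phi ?Rmap_Phi; [|exact: hTG..].
rewrite (rho_T Gx Tx) xt -comp_lfunZr -comp_lfunZl !lineZ//.
split; congr <[_]>%VS; apply: rho_eq => k; rewrite comp_lfunE !Phi_basis//.
  by rewrite linearZ /= Phi_basis// scalerA mM mulrC.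
by rewrite linearZ /= Phi_basis// scalerA mM.
Qed.

(** On [T] both translations are [Fmap] after the map [s] with coordinates [zz 0 j / alpha j t]. The
    derivative of coordinate [j] at 1 is [- delta (alpha j) * zz 0 j]. *)
Lemma torus_action zz (e : 'I_l -> functional K 'rV[K]_l) delta f :
  (forall j, is_coordinate_vector zz j (e j)) -> Lie T delta ->
  germ (E := projective 'End(V)) Gb (Fmap v nn zz) f ->
  delta (f \o Lz zz) = - \sum_j delta (alpha j) * zz 0 j * e j (f \o Fmap v nn) /\
  delta (f \o Rz zz) = - \sum_j delta (alpha j) * zz 0 j * e j (f \o Fmap v nn).
Proof.
move=> he hd /biaction_gradient[[f' rf' ff'] gL gR _].
have [_ T1 _ _] := hT.
have R := @affine_regular_ring K 'M[K]_N.
have ga j : germ (E := Mat K N) T 1%:M (alpha j) by case: (halpha j) => + _ _; apply.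
have a1 j : alpha j 1%:M = 1 by case: (halpha j).
have gV j : germ (E := Mat K N) T 1%:M (fun t => (alpha j t)^-1).
  by apply: germ_inv => //; rewrite a1 oner_neq0.
have dV j : delta (fun t => (alpha j t)^-1) = - delta (alpha j).
  have := hd.2 _ _ (ga j) (gV j); rewrite a1 invr1 !mul1r => E.
  apply/eqP; rewrite -addr_eq0 -E.
  rewrite (tangent_eq R hd T1 (germ_mul R (ga j) (gV j)) (g := fun=> 1)).
    by rewrite (tangent_cst R hd).
  by move=> t Tt; rewrite divff//; case: (characterV hT (halpha j) Tt).
pose s t : 'rV[K]_l := \row_j (zz 0 j / alpha j t).
have s1 : s 1%:M = zz by apply/rowP => j; rewrite mxE a1 divr1.
have fr (w : 'rV[K]_l) : w = \sum_j w 0 j *: delta_mx 0 j.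
  exact: row_sum_delta.
have [D hD] := chain_rule fr rf'.
have gs j : germ (E := Mat K N) T 1%:M ((fun w : 'rV[K]_l => w 0 j) \o s).
  by apply: germ_eq (germ_scale R (zz 0 j) (gV j)) _ => t _; rewrite /= /s mxE.
have gc j : germ (E := affine 'rV[K]_l) setT zz ((fun w : 'rV[K]_l => w 0 j) \o id).
  by apply: germ_linear => k a b; rewrite /= !mxE.
have [gfs dfs] := hD _ _ _ _ s1 T1 gs.
have [_ de] := hD _ _ _ id erefl I gc.
(* [D] is the gradient of [f'], a representative of [f] after [Fmap], so [e j] extracts its [j]-th
   partial derivative. *)
have ej j : e j (f \o Fmap v nn) = D j.
  rewrite (_ : f \o _ = f' \o id); last by apply: funext => c; apply: (ff' _ I).
  have [te ec] := he j; rewrite de// (bigD1 j)//= big1 => [|i /negPf ij].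
    by rewrite [X in D j * X]ec eqxx mulr1 addr0.
  by rewrite [X in D i * X]ec ij mulr0.
have dD : delta (f' \o s) = - \sum_j delta (alpha j) * zz 0 j * e j (f \o Fmap v nn).
  rewrite dfs// -sumrN; apply: eq_bigr => j _.
  rewrite (_ : _ \o s = fun t => zz 0 j * (alpha j t)^-1); last first.
    by apply: funext => t; rewrite /= /s mxE.
  by rewrite (tangentZ R hd)// dV ej !mulrN mulrC [zz 0 j * _]mulrC.
split; rewrite -dD; apply: (tangent_eq R hd T1) => [|t Tt].
- exact: (germ_sub (E := Mat K N) hTG gL).
- by rewrite /= (biaction_T zz Tt).1; apply: (ff' _ I).
- exact: (germ_sub (E := Mat K N) hTG gR).
- by rewrite /= (biaction_T zz Tt).2; apply: (ff' _ I).
Qed.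

(** Every [alpha i] is 1 at the identity, so the Leibniz rule turns the product of powers into a sum
    with weights [m i]. *)
Lemma pairing_prod delta (m : 'I_l -> nat) beta : Lie T delta ->
  is_character T beta -> (forall t, T t -> beta t = \prod_i alpha i t ^+ m i) ->
  delta beta = \sum_i (m i)%:R * delta (alpha i).
Proof.
move=> hd hb bE; have [_ T1 _ _] := hT.
have R := @affine_regular_ring K 'M[K]_N.
have ga j : germ (E := Mat K N) T 1%:M (alpha j) by case: (halpha j) => + _ _; apply.
have a1 j : alpha j 1%:M = 1 by case: (halpha j).
have gb : germ (E := Mat K N) T 1%:M beta by case: hb => + _ _; apply.
rewrite (tangent_eq R hd T1 gb bE).
elim: (index_enum _) => [|i s IH].
  rewrite big_nil; apply: etrans (tangent_cst R hd 1); congr delta.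
  by apply: funext => t; rewrite big_nil.
rewrite big_cons -IH (_ : (fun t => _) =
    fun t => alpha i t ^+ m i * \prod_(j <- s) alpha j t ^+ m j); last first.
  by apply: funext => t; rewrite big_cons.
have gp : germ (E := Mat K N) T 1%:M (fun t => \prod_(j <- s) alpha j t ^+ m j).
  by apply: (germ_prod R) => j; apply: (germ_exp R).
rewrite hd.2//; last exact: (germ_exp R).
rewrite (tangent_exp R hd)// a1 !expr1n big1 => [|j _]; last by rewrite a1 expr1n.
by rewrite !mul1r mulr1 addrC.
Qed.

End Cover.

(** * Exponents from coweights and the six formulas *)

Lemma natvalE (K : numFieldType) (m : nat) : natval (m%:R : K) = m.
Proof.
rewrite /natval; case: xgetP => [k _ /= /eqP|/(_ m)/=]; last by case.
by rewrite eqr_nat => /eqP.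
Qed.

Theorem lemma2p10 (R : realType) (M N l n : nat)
  (* G: connected semisimple of adjoint type; T, B, B^-, U^+, U^- *)
  (G T B Bm Up Um : set 'M[R[i]]_N)
  (hG : semisimple G) (hGad : adjoint_type G)
  (hT : maximal_torus l T G)
  (hB : borel B G) (hTB : T `<=` B)
  (hBm : borel Bm G) (hBBm : B `&` Bm = T)
  (hUp : unipotent_radical Up B) (hUm : unipotent_radical Um Bm)
  (* simple roots alpha_i, fundamental coweights, sl2-triples *)
  (alpha : 'I_l -> 'M[R[i]]_N -> R[i])
  (halpha : simple_roots G T B alpha)
  (coweight : 'I_l -> functional R[i] 'M[R[i]]_N)
  (hcoweight : forall i, Lie T (coweight i))
  (hdual : forall i j, pairing (coweight i) (alpha j) = (i == j)%:R)
  (x y h : ('M[R[i]]_N -> R[i]) -> functional R[i] 'M[R[i]]_N)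
  (hx : forall beta, positive_root G T B beta ->
     Lie Up (x beta) /\ root_space G T beta (x beta))
  (hy : forall beta, positive_root G T B beta ->
     Lie Um (y beta) /\ root_space G T (fun t => (beta t)^-1) (y beta))
  (hh : forall beta, positive_root G T B beta -> Lie T (h beta))
  (hsl2 : forall beta, positive_root G T B beta ->
     sl2_triple G (x beta) (y beta) (h beta))
  (* universal cover of G, and its irreducible representation V of regular
     highest weight lam *)
  (Gt : set 'M[R[i]]_M) (pi : 'M[R[i]]_M -> 'M[R[i]]_N)
  (hpi : universal_cover Gt G pi)
  (V : vectType R[i]) (rho : 'M[R[i]]_M -> 'End(V))
  (hrho : representation Gt rho) (hirr : irreducible Gt rho)
  (lam : 'M[R[i]]_M -> R[i])
  (hlam : is_character [set t | Gt t /\ T (pi t)] lam)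
  (hreg : forall beta, positive_root G T B beta ->
     exists ht : functional R[i] 'M[R[i]]_M,
       [/\ Lie [set t | Gt t /\ T (pi t)] ht,
           eq_Lie T (differential pi ht) (h beta) &
           pairing ht lam != 0])
  (* the weight basis v_0, ..., v_n, and the exponents n_{ik} = nn k i *)
  (v : n.+1.-tuple V) (hv : basis_of fullv v)
  (nn : 'I_n.+1 -> 'I_l -> nat)
  (hhigh : forall b, Gt b -> B (pi b) ->
     rho b (tnth v ord0) \in <[tnth v ord0]>%VS)
  (hwt : forall k t, Gt t -> T (pi t) ->
     rho t (tnth v k) =
       (lam t * \prod_(i < l) (alpha i (pi t)) ^- nn k i) *: tnth v k)
  (hn0 : forall i, nn ord0 i = 0%N)
  (hln : (l <= n)%N)
  (hn1 : forall (k : 'I_n.+1) (i : 'I_l), k = i.+1 :> nat ->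
     forall j, nn k j = (i == j))
  (* the point z = F(z_1, ..., z_l), and the standard basis e_j of C^l *)
  (zz : 'rV[R[i]]_l)
  (e : 'I_l -> functional R[i] 'rV[R[i]]_l)
  (he : forall j, is_coordinate_vector zz j (e j)) :
  let z := Fmap v nn zz in
  let dL' := dL Gt pi rho z in
  let dR' := dR Gt pi rho z in
  let dA' := dA Gt pi rho v nn zz in
  let o := @zero_functional R[i] 'M[R[i]]_N in
  let o' := @zero_functional R[i] 'rV[R[i]]_l in
  let eqT := eq_tangent (E := projective 'End(V)) (Gbar Gt G pi rho) z in
  let zpow (beta : 'M[R[i]]_N -> R[i]) :=
    \prod_(i < l) zz 0 i ^+ natval (pairing (coweight i) beta) in
  let a i j := pairing (h (alpha i)) (alpha j) in
  (forall beta, positive_root G T B beta ->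
     [/\ eqT (dL' (x beta)) (fun f => - dA' o (x beta) o' f),
         eqT (dL' (y beta)) (fun f => zpow beta * dA' (y beta) o o' f),
         eqT (dR' (x beta)) (fun f => - (zpow beta * dA' o (x beta) o' f)) &
         eqT (dR' (y beta)) (dA' (y beta) o o')]) /\
  (forall i : 'I_l,
     eqT (dL' (h (alpha i)))
         (fun f => - \sum_(j < l) a i j * zz 0 j * dA' o o (e j) f) /\
     eqT (dR' (h (alpha i)))
         (fun f => - \sum_(j < l) a i j * zz 0 j * dA' o o (e j) f)).
Proof.
move=> z dL' dR' dA' o o' eqT zpow a.
have sG : subgroup G by case: hG => -[[]].
have hTG : T `<=` G by case: hT.
have sT : subgroup T by case: hT => -[[]].
have sGt : subgroup Gt by case: hpi => -[[]].
have hiso : isogeny Gt G pi by case: hpi.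
have [pos_alpha hind hroot] := halpha.
have ca i : is_character T (alpha i) by case: (pos_alpha i).
have Rp := @projective_regular_ring R[i] 'End(V).
(* Coroots first: [h (alpha i)] lies in Lie [T], hence in Lie [G], and [a i j] unfolds to its value
   on [alpha j]. *)
split=> [beta hb|i]; last first.
  have hd := hh _ (pos_alpha i).
  have hdG : Lie G (h (alpha i)) by apply: (tangent_sub (E := Mat R[i] N) hTG hd).
  have tL := tangent_dL sG sT hTG sGt hiso hrho hlam ca hind hv hwt hn0 zz hdG.
  have tR := tangent_dR sG sT hTG sGt hiso hrho hlam ca hind hv hwt hn0 zz hdG.
  have act f := torus_action sG sT hTG sGt hiso hrho hlam ca hind hv hwt hn0
    (f := f) he hd.
  have eA j f : dA' o o (e j) f = e j (f \o Fmap v nn).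
    exact: (dA_e sG sT sGt hiso hrho hlam ca hv hwt hn0).
  split.
    apply: (eq_tangent_germ Rp tL) => f /act[eL _].
    by apply: (etrans eL); congr (- _); apply: eq_bigr => j _; rewrite eA.
  apply: (eq_tangent_germ Rp tR) => f /act[_ eR].
  by apply: (etrans eR); congr (- _); apply: eq_bigr => j _; rewrite eA.
have cb : is_character T beta by case: hb.
have [m bE] := hroot _ hb.
(* By duality, pairing [coweight i] with [beta] gives the exponent [m i] of [alpha i] in [beta],
   which [natval] recovers in characteristic 0. *)
have zE : zpow beta = \prod_i zz 0 i ^+ m i.
  apply: eq_bigr => i _; congr (_ ^+ _).
  rewrite /pairing (pairing_prod sT ca (hcoweight i) cb bE).
  under eq_bigr => j _ do rewrite [coweight i _]hdual.
  rewrite (bigD1 i)//= eqxx mulr1 big1 ?addr0 ?natvalE// => j /negPf ji.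
  by rewrite eq_sym ji mulr0.
have [_ hx2] := hx _ hb; have [_ hy2] := hy _ hb.
have xL := tangent_dL sG sT hTG sGt hiso hrho hlam ca hind hv hwt hn0 zz hx2.1.
have xR := tangent_dR sG sT hTG sGt hiso hrho hlam ca hind hv hwt hn0 zz hx2.1.
have yL := tangent_dL sG sT hTG sGt hiso hrho hlam ca hind hv hwt hn0 zz hy2.1.
have yR := tangent_dR sG sT hTG sGt hiso hrho hlam ca hind hv hwt hn0 zz hy2.1.
(* Expressing [dA'] as minus the left action on [x beta] and as the right action on [y beta] reduces
   the formulas to comparing the two translations. *)
have eX f := dA_x sG sT hTG sGt hiso hrho hlam ca hind hv hwt hn0
  (zz := zz) (f := f) hx2.1.
have eY : dA' (y beta) o o' = dR' (y beta) by exact: dA_y.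
split.
- by apply: (eq_tangent_germ Rp xL) => f /eX eXf; rewrite [dA' _ _ _ _]eXf opprK.
- apply: (eq_tangent_germ Rp yL) => f gf; rewrite eY zE.
  exact: (negative_root_action sG sT hTG sGt hiso hrho hlam ca hind hv hwt hn0 hy2 bE gf).
- apply: (eq_tangent_germ Rp xR) => f gf.
  rewrite [dA' _ _ _ _](eX f gf) mulrN opprK zE.
  exact: (positive_root_action sG sT hTG sGt hiso hrho hlam ca hind hv hwt hn0 hx2 bE gf).
- by apply: (eq_tangent_germ Rp yR) => f _; rewrite eY.
Qed.
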